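(* Let $q$ be a power of a prime $p$, and let $V$ be a vector space over $\mathbb{F}_{q^p}$ written as a tensor product $V=U\otimes W$ over $\mathbb{F}_{q^p}$ with $2\le\dim U\le\dim W$. Let $H\le\Gamma L(V)_{U\otimes W}$ be $p$-exceptional on $V$ and such that $H\cap GL(V)$ has order coprime to $p$. Then $p=\dim U=2$; in particular $H\cap GL(V)$ is not absolutely irreducible on $V$.
   Context: Fix bases $u_1,\dots,u_a$ of $U$ and $w_1,\dots,w_b$ of $W$. $\Gamma L(V)_{U\otimes W}$ is the stabiliser of the tensor decomposition in $\Gamma L(V)$: the group generated by $GL(U)\circ GL(W)$ (acting by $u\otimes w\mapsto uA\otimes wB$) and the field automorphism $\sigma:\sum a_{ij}u_i\otimes w_j\mapsto\sum a_{ij}^pu_i\otimes w_j$. A group $G\le\Gamma L(V)$ is $p$-exceptional if $p$ divides $|G|$ and every orbit of $G$ on $V$ has size coprime to $p$. *)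

(* Defs.v *)
From HB Require Import structures.
From mathcomp Require Import all_boot all_order all_algebra all_fingroup all_field.
Set Implicit Arguments. Unset Strict Implicit. Unset Printing Implicit Defensive.
Import GRing.Theory.

(* V = U (x) W is modelled by coordinate matrices: X : 'M[F]_(a,b) stands for
   sum_{i,j} X i j  u_i (x) w_j.  Elements of GammaL(V) are permutations of V. *)

(* Generators of GammaL(V)_{U(x)W}: the maps X |-> P X Q (P, Q invertible),
   i.e. u (x) w |-> uA (x) wB with P = A^T, Q = B, and the field automorphism
   sigma : X |-> X^[p] (entrywise p-th power). *)
Definition tensor_gens (F : finFieldType) (a b p : nat) : {set {perm 'M[F]_(a,b)}} :=
  [set s : {perm 'M[F]_(a,b)} | [exists P : 'M[F]_a, exists Q : 'M[F]_b,
      [&& P \in unitmx, Q \in unitmx & [forall X, s X == (P *m X *m Q)%R]]]]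
  :|: [set s : {perm 'M[F]_(a,b)} | [forall X, s X == map_mx (fun x : F => (x ^+ p)%R) X]].

Definition GammaL_UW (F : finFieldType) (a b p : nat) : {set {perm 'M[F]_(a,b)}} :=
  <<tensor_gens F a b p>>%g.

Definition GL_V (F : finFieldType) (a b : nat) : {set {perm 'M[F]_(a,b)}} :=
  [set s : {perm 'M[F]_(a,b)} | [forall c : F, forall X : 'M[F]_(a,b), forall Y : 'M[F]_(a,b),
      s (c *: X + Y)%R == (c *: s X + s Y)%R]].

Definition p_exceptional (F : finFieldType) (a b p : nat) (G : {set {perm 'M[F]_(a,b)}}) : bool :=
  (p %| #|G|) && [forall X : 'M[F]_(a,b), coprime #|orbit 'P G X| p].

Definition perm_mx (F : finFieldType) (a b : nat) (s : {perm 'M[F]_(a,b)}) : 'M[F]_(a * b) :=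
  lin1_mx (fun v : 'rV[F]_(a * b) => mxvec (s (vec_mx v))).

(* Absolute irreducibility of a set of linear maps, as in MathComp's
   mx_absolutely_irreducible: n > 0 and the enveloping algebra is all of End(V). *)
Definition abs_irr (F : finFieldType) (a b : nat) (S : {set {perm 'M[F]_(a,b)}}) : bool :=
  (0 < a * b)%N &&
  row_full (\matrix_(i < #|S|) mxvec (perm_mx (enum_val i)))%R.

(* Main.v *)
Require Import Defs.
From HB Require Import structures.
From mathcomp Require Import all_boot all_order all_algebra all_fingroup all_field all_solvable.
From mathcomp Require Import zify ring.
Set Implicit Arguments. Unset Strict Implicit. Unset Printing Implicit Defensive.
Import GRing.Theory.

(* Write q = p^e, so that |F| = q^p, let tau be x |-> x^q and m = (q^p - 1) / (q - 1).
   By p-exceptionality every tensor of rank 2 is fixed by an element of H of order p, some power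
   of which is tau-semilinear.  It preserves the 2 x 2 block carrying the tensor, where it is
   Y |-> P tau(Y) Q; hence every M in GL_2(F) satisfies P tau(M) Q = M for such a pair (P, Q),
   which can be scaled so that P tau(P) ... tau^(p-1)(P) = 1, and likewise for Q^T.

   The matrices P arising in this way differ by elements of a p'-subgroup G of GL_2(F).  Count
   the pairs (P, v) with P tau(v) = v and v nonzero.  By Hilbert 90 each P contributes q^2 - 1
   vectors.  For a given v there are at most m matrices P, and at most one when the stabiliser of
   the line of v in G has order less than 3 modulo scalars.  Dickson's class equation shows that
   at most two lines have a larger stabiliser, unless the image of G in PGL_2(F) has at most m
   elements.  Either way there are at most m^2 matrices P, and at most m^2 matrices Q.

   A given pair (P, Q) accounts for at most |GL_2(q)| matrices M, and these pairs do not suffice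
   to cover GL_2(F): the hypotheses of the theorem are contradictory. *)

(** * Dickson's class equation *)

(** The disjunction records [u = s a] with [s >= 2]; from 6 on only an inequality is kept, so that
    each case is linear arithmetic. *)
Lemma dickson_half (u a : nat) :
  [\/ u = 2 * a, u = 3 * a | u = 4 * a \/ u = 5 * a \/ 6 * a <= u] -> 2 * a <= u.
Proof. by case=> [|| []]; lia. Qed.

(** The class equation with two classes. One of [u], [v] is [g] and the other is [g / 2]: two halves
    would force [a + b = z], and two copies of [g] exceed the total. If the class of full size has
    ratio 3, the other has ratio 2 and [g = 12 z]. *)
Lemma dickson_pair (g z u a v b : nat) : 0 < z -> z <= a -> z <= b ->
  (u - a) + (v - b) + z = g ->
  u = g \/ 2 * u = g -> v = g \/ 2 * v = g ->
  [\/ u = 2 * a, u = 3 * a | u = 4 * a \/ u = 5 * a \/ 6 * a <= u] ->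
  [\/ v = 2 * b, v = 3 * b | v = 4 * b \/ v = 5 * b \/ 6 * b <= v] ->
  (u = 2 * a /\ b = z \/ v = 2 * b /\ a = z) \/
  [/\ g <= 60 * z, ~~ odd g & 3 %| g \/ g <= 10 * z].
Proof.
move=> z0 za zb e hu hv /[dup]/dickson_half wa ha /[dup]/dickson_half wb hb.
have d3 m w : m = 3 * w -> 3 %| m by move=> ->; rewrite dvdn_mulr.
have od m w : 2 * w = m -> ~~ odd m by move=> <-; rewrite mul2n odd_double.
have {hu hv} [[e1 e2]|[e1 e2]] : u = g /\ 2 * v = g \/ v = g /\ 2 * u = g by lia.
- subst u; case: ha => [?|?|ha]; last by exfalso; clear -z0 za zb e e2 wb ha; lia.
    by left; lia.
  right; split; [|apply: od e2 | left; apply: d3; eassumption].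
  by case: hb => [?|?|[?|[?|?]]]; lia.
- subst v; case: hb => [?|?|hb]; last by exfalso; clear -z0 za zb e e2 wa hb; lia.
    by left; lia.
  right; split; [|apply: od e2 | left; apply: d3; eassumption].
  by case: ha => [?|?|[?|[?|?]]]; lia.
Qed.

(** With [u = s1 a = s2 b = s3 c] the equation reads [1/s1 + 1/s2 + 1/s3 = 1 + z/u]. Up to order the
    solutions are [(2,2,n)], where the third summand is [z], and [(2,3,3)], [(2,3,4)], [(2,3,5)],
    where [u] is [6 z], [12 z], [30 z]. *)
Lemma dickson_triple (u a b c z : nat) : 0 < z -> a + b + c = u + z ->
  [\/ u = 2 * a, u = 3 * a | u = 4 * a \/ u = 5 * a \/ 6 * a <= u] ->
  [\/ u = 2 * b, u = 3 * b | u = 4 * b \/ u = 5 * b \/ 6 * b <= u] ->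
  [\/ u = 2 * c, u = 3 * c | u = 4 * c \/ u = 5 * c \/ 6 * c <= u] ->
  [\/ u = 2 * b /\ u = 2 * c /\ a = z, u = 2 * a /\ u = 2 * c /\ b = z
    | u = 2 * a /\ u = 2 * b /\ c = z] \/
  u <= 30 * z /\ (3 %| u \/ u <= 5 * z).
Proof.
move=> z0 e; have d3 v w : v = 3 * w -> 3 %| v by move=> ->; rewrite dvdn_mulr.
by do 3! [case=> [?|?|[?|[?|?]]]];
  first [ exfalso; lia | left; constructor 1; lia | left; constructor 2; lia | left; constructor 3; lia
        | right; split; [lia | first [by right; lia | by left; apply: d3; eassumption]]].
Qed.

(* In the application [i] runs over the classes of subgroups [C_G(x)], [x] not scalar: [t i] is the
   number of subgroups in the class, [c i] their order and [z] the number of scalars. *)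
Lemma dickson_arith (I : eqType) (l : seq I) (t c : I -> nat) (g z : nat) :
  uniq l ->
  (forall i, i \in l -> 0 < t i /\ exists s, [/\ c i = s * z, 2 <= s &
      t i * c i = g \/ 2 * (t i * c i) = g]) ->
  \sum_(i <- l) t i * (c i - z) + z = g -> 0 < z ->
  (forall i, i \in l -> 3 * z <= c i ->
     t i = 1 /\ forall j, j \in l -> 3 * z <= c j -> i = j)
  \/ [/\ g <= 60 * z, ~~ odd g & 3 %| g \/ g <= 10 * z].
Proof.
move=> ul hl hs z0.
(* [T] and [u] stand for [t z] and [t c]: the class contributes [u - T], and [u / T] is the order
   [c / z] of the centralizer modulo scalars. *)
pose Q i (T u : nat) := [/\ T = t i * z, t i * (c i - z) = u - T, z <= T, u = g \/ 2 * u = g &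
   [/\ T = z -> t i = 1, 3 * z <= c i -> 3 * T <= u &
   [\/ u = 2 * T, u = 3 * T | u = 4 * T \/ u = 5 * T \/ 6 * T <= u]]].
have Qi i : i \in l -> exists T u, Q i T u.
  move=> /hl [ti [s [cs s2 e]]]; exists (t i * z), (t i * c i); split=> //; last split.
  - by rewrite mulnBr.
  - by rewrite leq_pmull.
  - by rewrite -{2}(mul1n z) => /eqP; rewrite eqn_pmul2r // => /eqP.
  - by move=> h; rewrite mulnCA leq_mul2l h orbT.
  - rewrite cs; case: s s2 {cs e} => [|[|[|[|[|[|s]]]]]] // _.
    + by constructor 1; lia.
    + by constructor 2; lia.
    + by constructor 3; lia.
    + by constructor 3; lia.
    + by constructor 3; right; right; nia.
case: l ul hl hs Qi => [|i1 [|i2 [|i3 [|i4 l]]]].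
- by left.
- rewrite big_seq1 => _ _ hs Qi; left=> i; rewrite inE => /eqP -> {i} h.
  split; last by move=> j; rewrite inE => /eqP.
  have [T [u [_ e1 e2 e3 [e4 e5 e6]]]] := Qi i1 (mem_head _ _).
  by apply: e4; lia.
- rewrite !big_cons big_nil => _ _ hs Qi.
  have [T1 [u1 [_ e1 b1 d1 [f1 k1 a1]]]] := Qi i1 (mem_head _ _).
  have [T2 [u2 [_ e2 b2 d2 [f2 k2 a2]]]] := Qi i2 (mem_last _ [:: _]).
  rewrite e1 e2 addn0 in hs.
  have [[[x1 x2]|[x1 x2]]|] := dickson_pair z0 b1 b2 hs d1 d2 a1 a2; clear a1 a2 d1 d2 hs;
    last by right.
  + left=> i; rewrite !inE => /orP[] /eqP -> {i}; first by move/k1; lia.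
    move=> /k2 h; split; first exact: f2.
    by move=> j; rewrite !inE => /orP[] /eqP -> // /k1; lia.
  + left=> i; rewrite !inE => /orP[] /eqP -> {i}; last by move/k2; lia.
    move=> /k1 h; split; first exact: f1.
    by move=> j; rewrite !inE => /orP[] /eqP -> // /k2; lia.
- rewrite !big_cons big_nil => _ _ hs Qi.
  have [T1 [u1 [_ e1 b1 d1 [f1 k1 a1]]]] := Qi i1 (mem_head _ _).
  have [T2 [u2 [_ e2 b2 d2 [f2 k2 a2]]]] := Qi i2 ltac:(by rewrite !inE eqxx orbT).
  have [T3 [u3 [_ e3 b3 d3 [f3 k3 a3]]]] := Qi i3 ltac:(by rewrite !inE eqxx !orbT).
  rewrite e1 e2 e3 addn0 in hs.
  have w1 : 2 * T1 <= u1 by apply: dickson_half a1.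
  have w2 : 2 * T2 <= u2 by apply: dickson_half a2.
  have w3 : 2 * T3 <= u3 by apply: dickson_half a3.
  have {d1 d2 d3}[d1 u21 u31] : [/\ 2 * u1 = g, u2 = u1 & u3 = u1].
    by clear -hs d1 d2 d3 w1 w2 w3 z0 b1 b2 b3; split; lia.
  subst u2 u3.
  have hT : T1 + T2 + T3 = u1 + z by clear -hs d1 w1 w2 w3; lia.
  have [[[x1 [x2 x3]]|[x1 [x2 x3]]|[x1 [x2 x3]]]|[x1 x2]] := dickson_triple z0 hT a1 a2 a3;
    clear a1 a2 a3.
  + left=> i; rewrite !inE => /or3P[] /eqP -> {i} h.
    * split; first exact: f1.
      by move=> j; rewrite !inE => /or3P[] /eqP -> // => [/k2|/k3]; lia.
    * by move/k2: h; lia.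
    * by move/k3: h; lia.
  + left=> i; rewrite !inE => /or3P[] /eqP -> {i} h; [by move/k1: h; lia| |by move/k3: h; lia].
    split; first exact: f2.
    by move=> j; rewrite !inE => /or3P[] /eqP -> // => [/k1|/k3]; lia.
  + left=> i; rewrite !inE => /or3P[] /eqP -> {i} h; [by move/k1: h; lia|by move/k2: h; lia|].
    split; first exact: f3.
    by clear Qi; move=> j; rewrite !inE => /or3P[] /eqP -> // => [/k1|/k2]; lia.
  + right; split; [by clear -d1 x1; lia | by rewrite -d1 mul2n odd_double |].
    by case: x2 => x2; [left; rewrite -d1 dvdn_mull | right; clear -d1 x2; lia].
(* With four classes or more, each contributes at least half of [u >= g / 2]; together with [z > 0]
   the sum exceeds [g]. *)
- rewrite !big_cons => _ _ hs Qi; exfalso.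
  have [T1 [u1 [_ e1 b1 d1 [_ _ a1]]]] := Qi i1 (mem_head _ _).
  have [T2 [u2 [_ e2 b2 d2 [_ _ a2]]]] := Qi i2 ltac:(by rewrite !inE eqxx orbT).
  have [T3 [u3 [_ e3 b3 d3 [_ _ a3]]]] := Qi i3 ltac:(by rewrite !inE eqxx !orbT).
  have [T4 [u4 [_ e4 b4 d4 [_ _ a4]]]] := Qi i4 ltac:(by rewrite !inE eqxx !orbT).
  rewrite e1 e2 e3 e4 in hs.
  have w1 : 2 * T1 <= u1 by apply: dickson_half a1.
  have w2 : 2 * T2 <= u2 by apply: dickson_half a2.
  have w3 : 2 * T3 <= u3 by apply: dickson_half a3.
  have w4 : 2 * T4 <= u4 by apply: dickson_half a4.
  by clear -hs d1 d2 d3 d4 w1 w2 w3 w4 z0; lia.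
Qed.

(** * The class equation for centralizers in an abstract group *)

Section CentralizerDichotomy.
Local Open Scope group_scope.

(** Two centralizers of elements outside [Z] coincide or meet in [Z], so they partition [G :\: Z].
    Grouping them by conjugacy gives the equation of [dickson_arith], since the class of [C] has
    [|G : N(C)|] members and [|N(C) : C| <= 2]. In the first alternative there is at most one class
    of large centralizers, and it has a single member. *)
Lemma centralizer_dichotomy (gT : finGroupType) (G Z : {group gT}) :
  Z \subset G -> {in G & Z, forall x y, commute x y} ->
  {in G :\: Z &, forall x y, y \in 'C[x] -> 'C_G[x] \subset 'C_G[y]} ->
  {in G :\: Z, forall x, (#|'N_G('C_G[x])| <= 2 * #|'C_G[x]|)%N} ->
  {in G :\: Z &, forall x y, (3 * #|Z| <= #|'C_G[x]|)%N -> (3 * #|Z| <= #|'C_G[y]|)%N ->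
     'C_G[x] = 'C_G[y]}
  \/ [/\ (#|G| <= 60 * #|Z|)%N, ~~ odd #|G| & 3 %| #|G| \/ (#|G| <= 10 * #|Z|)%N].
Proof.
move=> sZG cGZ hC hN.
have eqC x y : x \in G :\: Z -> y \in G :\: Z -> y \in 'C[x] -> 'C_G[x] = 'C_G[y].
  move=> xG yG xy; apply/eqP; rewrite eqEsubset !hC //.
  by rewrite cent1C.
pose C x := 'C_G[x]; pose A := C @: (G :\: Z).
have CJ x g : g \in G -> C x :^ g = C (x ^ g).
  by move=> gG; rewrite /C conjIg conjGid // cent1J.
have nZ : G \subset 'N(Z).
  by apply: cents_norm; apply/centsP=> x xG y yZ; apply: cGZ.
have GZJ x g : g \in G -> (x ^ g \in G :\: Z) = (x \in G :\: Z).
  by move=> gG; rewrite !inE memJ_norm ?(subsetP nZ) // groupJr.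
have actA : [acts G, on A | 'Js].
  apply/actsP=> g gG B; apply/imsetP/imsetP=> -[x xG e].
    by exists (x ^ g^-1); rewrite ?GZJ ?groupV // -CJ ?groupV // -e /= conjsgK.
  by exists (x ^ g); rewrite ?GZJ // -CJ // -e.
have sZC x : x \in G -> Z \subset C x.
  move=> xG; apply/subsetP=> y yZ; rewrite inE (subsetP sZG) //=.
  by apply/cent1P; apply/commute_sym/cGZ.
have sumA : (\sum_(B in A) (#|B| - #|Z|) + #|Z| = #|G|)%N.
  rewrite -(cardsID Z G) (setIidPr sZG) addnC; congr addn.
  rewrite -[RHS]sum1_card [RHS](partition_big C (mem A)) /=; last by move=> x xG; apply: imset_f.
  apply: eq_bigr => B /imsetP[x xG ->].
  have xG' : x \in G by case/setDP: xG.
  have -> : (#|C x| - #|Z| = #|C x :\: Z|)%N by rewrite cardsD (setIidPr (sZC x xG')).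
  rewrite -sum1_card; apply: eq_bigl => y.
  apply/idP/andP => [|[yG /eqP e]]; last first.
    by case/setDP: yG => yG yZ; rewrite -e inE yZ inE yG cent1id.
  rewrite inE => /andP[yZ yC]; have yG : y \in G :\: Z by rewrite inE yZ; case/setIP: yC.
  by rewrite yG /C (eqC x y) ?eqxx //; case/setIP: yC.
pose O := [set orbit 'Js G B | B in A].
(* One centralizer is chosen in each class; the default [set0] does not occur for [T] in [O]. *)
pose rep (T : {set {set gT}}) := odflt set0 [pick B in A | orbit 'Js G B == T].
have repP T : T \in O -> exists2 x, x \in G :\: Z & rep T = C x /\ orbit 'Js G (C x) = T.
  case/imsetP=> B BA ->; rewrite /rep; case: pickP => [D /andP[/imsetP[x xG ->] /eqP e]|].
    by exists x.
  by move/(_ B); rewrite BA eqxx.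
have cardO x : x \in G -> (#|orbit 'Js G (C x)| * #|'N_G(C x)| = #|G|)%N.
  by move=> xG; rewrite -(card_orbit_stab 'Js G (C x)) astab1Js.
have sumO : (\sum_(T <- enum O) #|T| * (#|rep T| - #|Z|) + #|Z| = #|G|)%N.
  rewrite -sumA big_enum /=; congr addn.
  rewrite [RHS](partition_big (orbit 'Js G) (mem O)) /=; last by move=> B BA; apply: imset_f.
  apply: eq_bigr => T TO; have [x xG [-> eT]] := repP T TO.
  rewrite -sum_nat_const; apply: eq_big => [B|B].
    apply/idP/andP => [|[_ /eqP <-]]; last exact: orbit_refl.
    rewrite -eT => BT; split; last by rewrite (orbit_eqP BT).
    by move: BT; apply/subsetP; rewrite acts_sub_orbit // imset_f.
  rewrite -{1}eT => /imsetP[g gG ->] /=; congr (_ - _)%N.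
  by rewrite cardJg.
have cardC x : x \in G :\: Z -> exists2 k, #|C x| = (k * #|Z|)%N & (2 <= k)%N.
  move=> /setDP[xG xZ]; exists #|C x : Z|; first by rewrite mulnC Lagrange ?sZC.
  by rewrite indexg_gt1; apply: contra xZ => /subsetP-> //; rewrite inE xG cent1id.
have hl T : T \in enum O -> (0 < #|T| /\ exists s, [/\ #|rep T| = s * #|Z|, 2 <= s &
    #|T| * #|rep T| = #|G| \/ 2 * (#|T| * #|rep T|) = #|G|])%N.
  rewrite mem_enum => /repP[x xG [-> eT]]; split.
    by rewrite -eT; apply/card_gt0P; exists (C x); apply: orbit_refl.
  have [k e k2] := cardC x xG; exists k; split=> //.
  have := cardO x; rewrite eT; case/setDP: (xG) => xG' _ /(_ xG') <-.
  have sCN : C x \subset 'N_G(C x) by rewrite subsetI subsetIl normG.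
  have /dvdnP[r er] := cardSg sCN.
  have r0 : (0 < r)%N by have := cardG_gt0 'N_G(C x); rewrite er; case: (r).
  have := hN x xG; rewrite -/(C x) {}er leq_pmul2r ?cardG_gt0 //.
  by case: r r0 => [|[|[|]]] // _ _; [left; rewrite mul1n | right; rewrite mulnCA].
have [h|h] := dickson_arith (enum_uniq _) hl sumO (cardG_gt0 _); last by right.
left=> x y xG yG cx cy.
have key u : u \in G :\: Z -> (3 * #|Z| <= #|C u|)%N ->
    orbit 'Js G (C u) \in enum O /\ (3 * #|Z| <= #|rep (orbit 'Js G (C u))|)%N.
  move=> uG cu; have uO : orbit 'Js G (C u) \in O by rewrite !imset_f.
  rewrite mem_enum; split=> //; have [v vG [-> ev]] := repP _ uO.
  have: C v \in orbit 'Js G (C u) by rewrite -ev orbit_refl.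
  by case/imsetP=> g _ ->; rewrite cardJg.
have [x1 x2] := key x xG cx; have [y1 y2] := key y yG cy.
have [cT /(_ _ y1 y2) e] := h _ x1 x2.
have [B eB] := cards1P (introT eqP cT).
have: C x = B by apply/set1P; rewrite -eB orbit_refl.
have: C y = B by apply/set1P; rewrite -eB e orbit_refl.
by rewrite /C => -> ->.
Qed.

End CentralizerDichotomy.

Local Open Scope ring_scope.

(** * Matrices of order two *)

Lemma mx2P (F : fieldType) (A B : 'M[F]_2) :
  A 0 0 = B 0 0 -> A 0 1 = B 0 1 -> A 1 0 = B 1 0 -> A 1 1 = B 1 1 -> A = B.
Proof.
move=> h00 h01 h10 h11; apply/matrixP=> i j.
have two (k : 'I_2) : k = 0 \/ k = 1 by case: k => [[|[|]]] // h; [left|right]; apply/val_inj.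
by case: (two i) => ->; case: (two j) => ->.
Qed.

Lemma cV2P (F : fieldType) (u v : 'cV[F]_2) : u 0 0 = v 0 0 -> u 1 0 = v 1 0 -> u = v.
Proof.
move=> h0 h1; apply/matrixP=> i j; rewrite ord1.
have two (k : 'I_2) : k = 0 \/ k = 1 by case: k => [[|[|]]] // h; [left|right]; apply/val_inj.
by case: (two i) => ->.
Qed.

Lemma sum2E (V : nmodType) (f : 'I_2 -> V) : \sum_i f i = f 0 + f 1.
Proof. by rewrite big_ord_recl big_ord1; congr (_ + f _); apply/val_inj. Qed.

Lemma det2E (F : fieldType) (A : 'M[F]_2) : \det A = A 0 0 * A 1 1 - A 0 1 * A 1 0.
Proof.
rewrite (expand_det_row A 0) sum2E /cofactor !det_mx11 !mxE /= addn0 expr0 expr1.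
rewrite mul1r mulN1r mulrN; congr (A _ _ * A _ _ - A _ _ * A _ _); exact/val_inj.
Qed.

Lemma tr2E (F : fieldType) (A : 'M[F]_2) : \tr A = A 0 0 + A 1 1.
Proof. by rewrite /mxtrace sum2E. Qed.

Lemma mx2_sqr (F : fieldType) (A : 'M[F]_2) : A *m A = \tr A *: A - (\det A)%:M.
Proof. by rewrite tr2E det2E; apply: mx2P; rewrite !(mxE, sum2E) /=; ring. Qed.

Lemma eq_of_sub (V : zmodType) (x y l r : V) : l = r -> x - y = l - r -> x = y.
Proof. by move=> -> /eqP; rewrite subrr subr_eq0 => /eqP. Qed.

(** A nonscalar matrix of order two is cyclic, so its centralizer is [F[A] = F + F A]. The
    coefficient [b] is read off from the first nonzero value among [A 0 1], [A 1 0] and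
    [A 0 0 - A 1 1]. *)
Lemma mx2_comm (F : fieldType) (A B : 'M[F]_2) : ~~ is_scalar_mx A -> A *m B = B *m A ->
  exists a b, B = a%:M + b *: A.
Proof.
move=> nA /matrixP AB.
have := AB 0 0; have := AB 0 1; have := AB 1 0; rewrite !(mxE, sum2E) => e10 e01 e00.
have [a01|a01] := eqVneq (A 0 1) 0; last first.
  pose b := B 0 1 / A 0 1; have eb : B 0 1 = b * A 0 1 by rewrite divfK.
  rewrite eb in e10 e01 e00.
  exists (B 0 0 - b * A 0 0), b.
  apply: mx2P; rewrite !mxE /= ?mulr1n ?mulr0n ?add0r ?subrK // -/b.
    by apply: (mulfI a01); apply: (eq_of_sub e00); ring.
  by apply: (mulfI a01); apply: (eq_of_sub e01); ring.
have [a10|a10] := eqVneq (A 1 0) 0; last first.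
  pose b := B 1 0 / A 1 0; have eb : B 1 0 = b * A 1 0 by rewrite divfK.
  rewrite a01 eb in e10 e01 e00.
  exists (B 0 0 - b * A 0 0), b.
  apply: mx2P; rewrite !mxE /= ?mulr1n ?mulr0n ?add0r ?subrK // -/b ?a01 ?mulr0.
    by apply: (mulfI a10); apply: (eq_of_sub (esym e00)); ring.
  by apply: (mulfI a10); apply: (eq_of_sub (esym e10)); ring.
have a : A 0 0 - A 1 1 != 0.
  apply: contra nA; rewrite subr_eq0 => /eqP e; apply/is_scalar_mxP; exists (A 0 0).
  by apply: mx2P; rewrite !mxE /= ?mulr1n ?mulr0n.
pose b := (B 0 0 - B 1 1) / (A 0 0 - A 1 1).
have eb : B 0 0 - B 1 1 = b * (A 0 0 - A 1 1) by rewrite divfK.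
rewrite a01 a10 in e10 e01 e00.
exists (B 0 0 - b * A 0 0), b.
apply: mx2P; rewrite !mxE /= ?mulr1n ?mulr0n ?add0r ?subrK // -/b ?a01 ?a10 ?mulr0.
- by apply: (mulfI a); apply: (eq_of_sub e01); ring.
- by apply: (mulfI a); apply: (eq_of_sub (esym e10)); ring.
- by apply: (eq_of_sub (esym eb)); ring.
Qed.

Lemma mx2_cent_comm (F : fieldType) (A B C : 'M[F]_2) : ~~ is_scalar_mx A ->
  A *m B = B *m A -> A *m C = C *m A -> B *m C = C *m B.
Proof.
move=> nA /(mx2_comm nA)[a [b ->]] /(mx2_comm nA)[c [d ->]].
by apply: mx2P; rewrite !(mxE, sum2E) /=; ring.
Qed.

(* A conjugate of [A] inside the algebra [F[A]] is [A] itself or its Galois conjugate [tr A - A];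
   the discriminant hypothesis says that [F[A]] is separable. *)
Lemma mx2_conj (F : fieldType) (A B : 'M[F]_2) : ~~ is_scalar_mx A ->
  \tr A ^+ 2 - \det A *+ 4 != 0 -> A *m B = B *m A -> \tr B = \tr A -> \det B = \det A ->
  B = A \/ B = (\tr A)%:M - A.
Proof.
move=> nA dA /(mx2_comm nA)[a [b ->]]; set B' := _ + _.
have -> : \tr B' = a *+ 2 + b * \tr A by rewrite /B' !tr2E !mxE /=; ring.
have -> : \det B' = a ^+ 2 + a * b * \tr A + b ^+ 2 * \det A.
  by rewrite /B' !tr2E !det2E !mxE /=; ring.
move: (\tr A) (\det A) dA => t d dA et ed.
(* The discriminant of [a + b A] is [b ^ 2] times that of [A]. *)
have : (b - 1) * (b + 1) = 0.
  apply: (mulIf dA); rewrite mul0r.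
  have e2 : (a *+ 2 + b * t) ^+ 2 = t ^+ 2 by rewrite et.
  have e4 : (a ^+ 2 + a * b * t + b ^+ 2 * d) *+ 4 = d *+ 4 by rewrite ed.
  apply: (eq_of_sub (congr2 (fun x y => x - y) e2 e4)); ring.
have : a * (a + b * t) + (b ^+ 2 - 1) * d = 0.
  apply: (eq_of_sub ed); ring.
have two0 (x : F) : x *+ 2 = 0 -> x = 0 \/ (2%:R : F) = 0.
  by move/eqP; rewrite -[x *+ 2]mulr_natr mulf_eq0 => /orP[]/eqP; [left|right].
move=> ea /eqP; rewrite mulf_eq0 subr_eq0 addr_eq0 => /orP[]/eqP eb; subst b.
  have {}ea : a * (a + t) = 0 by rewrite -ea; ring.
  move/eqP: ea; rewrite mulf_eq0 addr_eq0 => /orP[]/eqP ea; subst a.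
    by left; rewrite /B' scale1r raddf0 add0r.
  have {}et : t *+ 2 = 0 by apply: (eq_of_sub (esym et)); ring.
  case: (two0 _ et) => [t0|c2]; first by left; rewrite /B' t0 scale1r oppr0 raddf0 add0r.
  right; apply/eqP; rewrite -subr_eq0; apply/eqP.
  have -> : B' - (t%:M - A) = 2%:R *: (A - t%:M) by rewrite /B'; apply: mx2P; rewrite !mxE /=; ring.
  by rewrite c2 scale0r.
have {}ea : a * (a - t) = 0 by rewrite -ea; ring.
move/eqP: ea; rewrite mulf_eq0 subr_eq0 => /orP[]/eqP ea; subst a; last first.
  by right; rewrite /B' scaleN1r.
have {}et : t *+ 2 = 0 by apply: (eq_of_sub (esym et)); ring.
case: (two0 _ et) => [t0|c2]; first by right; rewrite /B' t0 scaleN1r.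
left; apply/eqP; rewrite -subr_eq0; apply/eqP.
have -> : B' - A = - 2%:R *: A by rewrite /B'; apply: mx2P; rewrite !mxE /=; ring.
by rewrite c2 oppr0 scale0r.
Qed.

(* [2 A - tr A] squares to the discriminant of [A]. *)
Lemma mx2_insep (F : fieldType) (A : 'M[F]_2) (p : nat) : p \in [pchar F] ->
  \tr A ^+ 2 - \det A *+ 4 = 0 -> is_scalar_mx (A ^+ p).
Proof.
move=> pF dA; have [p2|p2] := eqVneq p 2%N.
  have c2 : (2%:R : F) = 0 by apply: pcharf0; rewrite -p2.
  move/eqP: dA; rewrite -mulr_natr (natrM _ 2 2) c2 mul0r mulr0 subr0 expf_eq0 /= => /eqP t0.
  apply/is_scalar_mxP; exists (- \det A); rewrite p2 expr2.
  by rewrite -[A * A]/(A *m A) mx2_sqr t0 scale0r raddfN add0r.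
have pM : p \in [pchar 'M[F]_2] by rewrite pchar_lalg.
have p_pr := pcharf_prime pF.
have n2 : (2%:R : F) ^+ p != 0.
  rewrite expf_eq0 prime_gt0 //= -(dvdn_pcharf pF).
  by rewrite dvdn_prime2.
pose N := 2%:R *: A - (\tr A)%:M.
have N2 : N ^+ 2 = 0.
  rewrite expr2 -[N * N]/(N *m N); transitivity ((\tr A ^+ 2 - \det A *+ 4)%:M : 'M[F]_2).
    by apply: mx2P; rewrite /N !tr2E !det2E !(mxE, sum2E) /=; ring.
  by rewrite dA raddf0.
have Np : N ^+ p = 0.
  by rewrite -(subnKC (prime_gt1 p_pr)) exprD N2 mul0r.
have e2 : 2%:R *: A = N + (\tr A)%:M by rewrite subrK.
have : (2%:R *: A) ^+ p = (\tr A ^+ p)%:M.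
  rewrite e2 -(pFrobenius_autE pM) pFrobenius_autD_comm; last by apply: scalar_mxC.
  by rewrite !pFrobenius_autE Np add0r rmorphXn.
rewrite exprZn => e; apply/is_scalar_mxP; exists ((2%:R ^+ p)^-1 * \tr A ^+ p).
by rewrite scalar_mxM -e mul_scalar_mx scalerA mulVf // scale1r.
Qed.

(** * Subgroups of GL_2 of order prime to the characteristic *)

Lemma GL_inj (F : finFieldType) : injective (@GLval 2 F).
Proof. exact: val_inj. Qed.

Section Scalars.
Variable F : finFieldType.
Implicit Type u : {'GL_2[F]}.

Definition GLscalar : {set {'GL_2[F]}} := [set u | is_scalar_mx (GLval u)].

Lemma GLscalar_group_set : group_set GLscalar.
Proof.
apply/group_setP; split=> [|u v]; first by rewrite inE GL_1E scalar_mx_is_scalar.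
rewrite !inE => /is_scalar_mxP[a ea] /is_scalar_mxP[b eb]; apply/is_scalar_mxP.
by exists (a * b); rewrite GL_MxE ea eb scalar_mxM.
Qed.
Canonical GLscalar_group := Group GLscalar_group_set.

Lemma GLscalarC u z : z \in GLscalar -> commute u z.
Proof.
rewrite inE => /is_scalar_mxP[a ea]; apply: GL_inj; rewrite !GL_MxE ea.
by rewrite scalar_mxC.
Qed.

Lemma GL_commuteE (u v : {'GL_2[F]}) : commute u v <-> GLval u *m GLval v = GLval v *m GLval u.
Proof.
rewrite -!GL_MxE; split=> [-> //|e]; exact: GL_inj.
Qed.

Lemma GL_valX u n : GLval (u ^+ n) = GLval u ^+ n.
Proof. by elim: n => [|n IH]; rewrite ?GL_1E // expgS exprS GL_ME IH. Qed.

Lemma GL_mulKV u : GLval u *m GLval u^-1 = 1%:M.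
Proof. by rewrite -GL_MxE mulgV GL_1E. Qed.

End Scalars.

Section PrimeToP.
Variables (F : finFieldType) (p : nat) (G : {group {'GL_2[F]}}).
Hypotheses (pF : p \in [pchar F]) (coGp : coprime #|G| p) (sZG : GLscalar F \subset G).
Let Z := GLscalar_group F.

(** The order of [u] is prime to [p], so [u] is a power of [u ^ p]. *)
Lemma scalar_of_expp u : u \in G -> is_scalar_mx (GLval u ^+ p) -> u \in Z.
Proof.
move=> uG up; have: (u ^+ p)%g \in Z by rewrite inE GL_valX.
rewrite -!cycle_subG; apply: subset_trans.
suff /eqP -> : generator <[u]> (u ^+ p)%g by [].
by rewrite generator_coprime (coprime_dvdl (order_dvdG uG)).
Qed.

Lemma primeto_sub_cent : {in G :\: Z &, forall x y, y \in 'C[x]%g -> 'C_G[x]%g \subset 'C_G[y]%g}.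
Proof.
move=> x y /setDP[xG]; rewrite inE => xZ _ /cent1P/GL_commuteE xy.
apply: setIS; apply/subsetP=> z /cent1P/GL_commuteE xz; apply/cent1P/GL_commuteE.
exact: (mx2_cent_comm xZ).
Qed.

(** Conjugation by the normalizer keeps [x] inside the algebra [F[x]], where the only candidates are
    [x] and [tr x - x]; the stabilizer of [x] centralizes it. The discriminant of [x] is nonzero, as
    otherwise [x ^ p], and hence [x], would be scalar. *)
Lemma primeto_card_norm_cent : {in G :\: Z, forall x, (#|'N_G('C_G[x])%g| <= 2 * #|'C_G[x]%g|)%N}.
Proof.
move=> x xGZ; have [xG xZ] := setDP xGZ; have nx : ~~ is_scalar_mx (GLval x) by rewrite inE in xZ.
have dx : \tr (GLval x) ^+ 2 - \det (GLval x) *+ 4 != 0.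
  by apply: contra xZ => /eqP /(mx2_insep pF); exact: scalar_of_expp.
rewrite -(card_orbit_stab 'J 'N_G('C_G[x])%G x) leq_mul //; last first.
  by rewrite subset_leq_card // astab1J -setIA setIA; apply: setSI; rewrite subsetIl.
pose S := [set y : {'GL_2[F]} | (GLval y == GLval x) || (GLval y == (\tr (GLval x))%:M - GLval x)].
apply: (@leq_trans #|S|).
  apply/subset_leq_card/subsetP => _ /imsetP[g /setIP[gG gN] ->]; rewrite inE -[('J)%act x g]/((x ^ g)%g).
  have /setIP[_ /cent1P/GL_commuteE xC] : (x ^ g \in 'C_G[x])%g.
    by rewrite memJ_norm // inE xG cent1id.
  have e : GLval (x ^ g) = GLval (g^-1)%g *m (GLval x *m GLval g).
    by rewrite conjgE !GL_MxE.
  suff [->|->] : GLval (x ^ g) = GLval x \/ GLval (x ^ g) = (\tr (GLval x))%:M - GLval x.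
  - by rewrite eqxx.
  - by rewrite eqxx orbT.
  apply: mx2_conj nx dx (esym xC) _ _.
    by rewrite e mxtrace_mulC -mulmxA GL_mulKV mulmx1.
  by rewrite e !det_mulmx mulrC -mulrA -det_mulmx GL_mulKV det1 mulr1.
have -> : S = [set y | GLval y == GLval x] :|: [set y | GLval y == (\tr (GLval x))%:M - GLval x].
  by apply/setP=> y; rewrite !inE.
have c1 (M : 'M[F]_2) : (#|[set y : {'GL_2[F]} | GLval y == M]| <= 1)%N.
  by apply/card_le1P=> y; rewrite inE => /eqP <- z; rewrite !inE.
by rewrite (leq_trans (leq_card_setU _ _)) // (leq_add (c1 _) (c1 _)).
Qed.

Lemma primeto_dichotomy :
  {in G :\: Z &, forall x y, (3 * #|Z| <= #|'C_G[x]%g|)%N -> (3 * #|Z| <= #|'C_G[y]%g|)%N ->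
     'C_G[x]%g = 'C_G[y]%g}
  \/ [/\ (#|G| <= 60 * #|Z|)%N, ~~ odd #|G| & (3 %| #|G|)%N \/ (#|G| <= 10 * #|Z|)%N].
Proof.
apply: centralizer_dichotomy primeto_sub_cent primeto_card_norm_cent => //.
by move=> u z _; apply: GLscalarC.
Qed.

Definition line_stab (v : 'cV[F]_2) : {set {'GL_2[F]}} :=
  [set u in G | [exists c, GLval u *m v == c *: v]].

Lemma line_stab_group_set v : group_set (line_stab v).
Proof.
apply/group_setP; split=> [|u w].
  by rewrite inE group1; apply/existsP; exists 1; rewrite GL_1E mul1mx scale1r.
rewrite !inE => /andP[uG /existsP[c /eqP ec]] /andP[wG /existsP[d /eqP ed]].
rewrite groupM //; apply/existsP; exists (d * c).
by rewrite GL_MxE -mulmxA ed -scalemxAr ec scalerA.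
Qed.
Canonical line_stab_group v := Group (line_stab_group_set v).

(** Both eigenvalues of [u] are 1, so its discriminant vanishes and [u ^ p] is scalar. Having order
    prime to [p], [u] is then scalar itself, and it fixes [v]. *)
Lemma unipotent1 (v : 'cV[F]_2) u : v != 0 -> u \in G -> GLval u *m v = v ->
  \det (GLval u) = 1 -> u = 1%g.
Proof.
move=> v0 uG uv du.
have d0 : \det (GLval u - 1%:M) = 0.
  rewrite -det_tr; apply/eqP/det0P; exists v^T; first by rewrite trmx_eq0.
  by rewrite -trmx_mul mulmxBl uv mul1mx subrr trmx0.
have tu : \tr (GLval u) = 2%:R.
  have e : \det (GLval u - 1%:M) = \det (GLval u) - \tr (GLval u) + 1.
    by rewrite !tr2E !det2E !mxE /=; ring.
  by rewrite du d0 in e; apply: (eq_of_sub e); ring.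
have : u \in Z.
  by apply: scalar_of_expp => //; apply: (mx2_insep pF); rewrite tu du; ring.
rewrite inE => /is_scalar_mxP[c ec]; apply: GL_inj; rewrite ec.
move/eqP: uv; rewrite ec mul_scalar_mx -subr_eq0 -{2}[v]scale1r -scalerBl scaler_eq0 (negPf v0).
by rewrite orbF subr_eq0 => /eqP ->.
Qed.

(** The commutator of two elements that stabilize the line fixes [v] and has determinant 1, hence is
    trivial: the line stabilizer is abelian. *)
Lemma line_stab_cent v x : v != 0 -> x \in line_stab v -> line_stab v \subset 'C_G[x]%g.
Proof.
move=> v0; rewrite inE => /andP[xG /existsP[c /eqP ec]].
apply/subsetP=> y; rewrite inE => /andP[yG /existsP[d /eqP ed]].
rewrite inE yG /=; apply/cent1P/commgP/eqP; apply: (unipotent1 v0); first exact: groupR.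
  have nz (z : {'GL_2[F]}) b : GLval z *m v = b *: v -> b != 0 /\ GLval z^-1 *m v = b^-1 *: v.
    move=> e; have b0 : b != 0.
      apply: contraNneq v0 => b0; move: e; rewrite b0 scale0r => e.
      by rewrite -[v](mulKmx (GL_unitmx z)) -[val z]/(GLval z) e mulmx0.
    split=> //; apply: (scalerI b0); rewrite scalerA mulfV // scale1r scalemxAr -e.
    by rewrite GL_VxE mulKmx ?GL_unitmx.
  have [c0 ec'] := nz _ _ ec; have [d0 ed'] := nz _ _ ed.
  rewrite commgEl conjgE !GL_MxE -!mulmxA ec -!scalemxAr ed -!scalemxAr ec' -!scalemxAr ed'.
  by rewrite !scalerA [X in X *: v](_ : _ = 1) ?scale1r //; field; rewrite c0 d0.
rewrite commgEl conjgE !GL_MxE !det_mulmx.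
have dV (z : {'GL_2[F]}) : \det (GLval z^-1) = (\det (GLval z))^-1 by rewrite GL_VxE det_inv.
by rewrite !dV; field; rewrite !GL_det.
Qed.

(** Modulo scalars the line stabilizer has order 1 or 2. *)
Lemma line_stab_small v u : u \in line_stab v -> (#|line_stab v| < 3 * #|Z|)%N ->
  (u ^+ 2)%g \in Z.
Proof.
move=> uv lt3; have sZL : Z \subset line_stab v.
  apply/subsetP=> z zZ; rewrite inE (subsetP sZG) //=.
  move: zZ; rewrite inE => /is_scalar_mxP[a ea]; apply/existsP; exists a.
  by rewrite ea mul_scalar_mx.
have nZL : (Z <| line_stab v)%g.
  rewrite /normal sZL; apply: cents_norm; apply/centsP=> x _ y yZ; exact: GLscalarC.
have : (#|line_stab v : Z|%g < 3)%N.
  by rewrite -(ltn_pmul2l (cardG_gt0 Z)) Lagrange // mulnC.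
have := indexg_gt0 (line_stab_group v) Z; rewrite -card_quotient ?normal_norm //.
have uN : u \in 'N(Z)%g by rewrite (subsetP (normal_norm nZL)).
have uQ : coset Z u \in (line_stab v / Z)%g by rewrite mem_quotient.
have := expg_cardG uQ.
have k n : (coset Z u ^+ n = 1 -> u ^+ n \in Z)%g.
  by rewrite -morphX // => /coset_idr; apply; rewrite groupX.
case: #|_| => [|[|[|n]]] /k uZ //.
by rewrite expg1 in uZ; rewrite groupX.
Qed.
End PrimeToP.

(** * Norms and Hilbert 90 *)

Lemma card_roots_Xn (F : finFieldType) (n : nat) (c : F) : (0 < n)%N ->
  (#|[set x : F | x ^+ n == c]| <= n)%N.
Proof.
move=> n0; have s : size ('X^n - c%:P) = n.+1 by rewrite size_XnsubC.
rewrite -ltnS -s cardE; apply: max_poly_roots; rewrite ?enum_uniq //.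
  by rewrite -size_poly_eq0 s.
apply/allP=> x; rewrite mem_enum inE => /eqP e.
by rewrite rootE !hornerE e subrr.
Qed.

Section Frob.
Variables (F : finFieldType) (q r : nat) (tau : {rmorphism F -> F}).
Hypotheses (q1 : (1 < q)%N) (r0 : (0 < r)%N) (cF : #|F| = (q ^ r)%N).
Hypothesis tauE : forall x, tau x = x ^+ q.

Let m := (\sum_(i < r) q ^ i)%N.

Lemma normexp_gt0 : (0 < m)%N.
Proof. by rewrite /m -(prednK r0) big_ord_recl expn0. Qed.

Lemma normexpE : (#|F|.-1 = q.-1 * m)%N.
Proof. by rewrite cF predn_exp. Qed.

Let q0 : (0 < q.-1)%N. Proof. by rewrite -ltnS prednK // ltnW. Qed.
Let K := [set x : F | x ^+ q.-1 == 1].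

Let card_norm_fibre_le (d : F) : (#|[set x : F | x ^+ m == d]| <= m)%N.
Proof. by apply: card_roots_Xn; exact: normexp_gt0. Qed.

Let sum_norm_fibre : (\sum_(d in K) #|[set x : F | x ^+ m == d]| = q.-1 * m)%N.
Proof.
have KN x : x != 0 -> x ^+ m \in K.
  move=> x0; rewrite inE -exprM mulnC -normexpE; apply/eqP/(mulfI x0).
  by rewrite -exprS prednK ?mulr1 ?expf_card // cF expn_gt0 (ltnW q1).
rewrite -normexpE -(cardsC1 (0 : F)) -[RHS]sum1_card.
rewrite [RHS](partition_big (fun x => x ^+ m) (mem K)) /=; last first.
  by move=> x; rewrite !inE => x0; have := KN x x0; rewrite inE.
apply: eq_bigr => d dK; rewrite -sum1_card; apply: eq_bigl => x.
rewrite !inE; have [->|//] := eqVneq x 0.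
rewrite expr0n gtn_eqF ?normexp_gt0 //=; apply: contraTF dK => /eqP <-.
by rewrite inE expr0n gtn_eqF // eq_sym oner_eq0.
Qed.

Let card_K : #|K| = q.-1.
Proof.
apply/eqP; rewrite eqn_leq card_roots_Xn //= -(leq_pmul2r normexp_gt0) -sum_norm_fibre.
by rewrite -sum_nat_const; apply: leq_sum.
Qed.

(** The [(q - 1) m] nonzero elements of [F] are spread over [q - 1] norm fibres of at most [m]
    elements each, so every fibre is full. *)
Lemma norm_fibre (c : F) : c != 0 -> c ^+ q = c -> #|[set x : F | x ^+ m == c]| = m.
Proof.
move=> c0 cq; have cK : c \in K.
  by rewrite inE; apply/eqP/(mulfI c0); rewrite -exprS prednK ?mulr1 // ltnW.
apply/eqP; rewrite eqn_leq card_norm_fibre_le /=.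
have h : (\sum_(d in K :\ c) #|[set x : F | x ^+ m == d]| <= #|K :\ c| * m)%N.
  by rewrite -sum_nat_const; apply: leq_sum.
move: sum_norm_fibre; rewrite (big_setD1 c) //= -card_K (cardsD1 c) cK mulSn => e.
by rewrite -(leq_add2r (#|K :\ c| * m)) -e leq_add2l.
Qed.

Definition fixedF := [set x : F | tau x == x].

Lemma card_fixedF : #|fixedF| = q.
Proof.
have -> : fixedF = 0 |: K.
  apply/setP=> x; rewrite !inE tauE; have [->|x0] := eqVneq x 0.
    by rewrite expr0n gtn_eqF ?eqxx // ltnW.
  by rewrite -{1}(prednK (ltnW q1)) exprS -{3}[x]mulr1 (inj_eq (mulfI x0)).
by rewrite cardsU1 card_K inE expr0n gtn_eqF // eq_sym oner_eq0 add1n prednK // ltnW.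
Qed.

Lemma card_fixed_cV2 : (q ^ 2 <= #|[set z : 'cV[F]_2 | map_mx tau z == z]|)%N.
Proof.
pose f (xy : F * F) : 'cV[F]_2 := \col_i (if i == 0 then xy.1 else xy.2).
have fI : injective f.
  by move=> [a b] [c d] /matrixP h; have := h 0 0; have := h 1 0; rewrite !mxE /= => -> ->.
rewrite -card_fixedF -mulnn -cardsX -(card_imset _ fI).
apply/subset_leq_card/subsetP=> z /imsetP[[a b]]; rewrite !inE /= => /andP[/eqP ea /eqP eb] ->.
by apply/eqP/matrixP=> i j; rewrite !mxE /=; case: ifP.
Qed.

(** The usual count of bases over the fixed field: a nonzero first column, then a second column
    outside its span. *)
Lemma card_fixed_GL2 :
  (#|[set Z : 'M[F]_2 | (Z \in unitmx) && (map_mx tau Z == Z)]| <= (q ^ 2 - 1) * (q ^ 2 - q))%N.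
Proof.
set S := [set Z | _]; pose f (Z : 'M[F]_2) := (Z 0 0, Z 1 0).
have fixE (Z : 'M[F]_2) i j : map_mx tau Z = Z -> Z i j \in fixedF.
  by move/matrixP/(_ i j); rewrite mxE inE => ->.
pose U := setX fixedF fixedF :\ (0, 0).
have cU : #|U| = (q ^ 2 - 1)%N.
  rewrite -mulnn -{1 2}card_fixedF -cardsX (cardsD1 (0, 0) (setX _ _)) !inE /= !rmorph0 !eqxx.
  by rewrite add1n subn1.
rewrite -cU -sum1_card (partition_big f (mem U)) /=; last first.
  move=> Z; rewrite inE => /andP[uZ /eqP tZ]; rewrite !inE /= -!/(_ \in fixedF).
  have := fixE Z 0 0 tZ; have := fixE Z 1 0 tZ; rewrite !inE => -> ->; rewrite !andbT.
  apply: contraTneq uZ => -[z0 z1]; rewrite unitmxE det2E z0 z1 mul0r mulr0 subr0.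
  by rewrite unitr0.
rewrite -sum_nat_const; apply: leq_sum => -[a b] /setD1P[ab0 /setXP[/= aK bK]].
rewrite sum1_card.
pose T := [set (t * a, t * b) | t in fixedF].
have TI : injective (fun t => (t * a, t * b)).
  move=> s t [ea eb]; move: ab0; rewrite xpair_eqE negb_and => /orP[] n0; apply: (mulIf n0) => //.
have sT : T \subset setX fixedF fixedF.
  apply/subsetP=> _ /imsetP[t tK ->]; move: aK bK tK; rewrite !inE /= !rmorphM.
  by move=> /eqP -> /eqP -> /eqP ->; rewrite !eqxx.
have cT : #|setX fixedF fixedF :\: T| = (q ^ 2 - q)%N.
  by rewrite cardsD (setIidPr sT) card_imset // cardsX !card_fixedF mulnn.
rewrite -cT; pose g (Z : 'M[F]_2) := (Z 0 1, Z 1 1).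
rewrite -(card_in_imset (f := g)); last first.
  move=> Z Z'; rewrite !unfold_in => /andP[_ /eqP e] /andP[_ /eqP e'] [h0 h1].
  have [e0 e1] : f Z = f Z' by rewrite e e'.
  exact: (mx2P e0 h0 e1 h1).
apply/subset_leq_card/subsetP=> x /imsetP[Z]; rewrite unfold_in inE.
move=> /andP[/andP[uZ /eqP tZ] /eqP[za zb]] ->; rewrite !inE.
have := fixE Z 0 1 tZ; have := fixE Z 1 1 tZ; rewrite !inE /= => -> ->; rewrite !andbT.
apply: contraTN uZ => /imsetP[t _ [e0 e1]].
by rewrite unitmxE det2E za zb e0 e1 -!mulrA (mulrCA a) (mulrC a b) subrr unitr0.
Qed.

Definition frob_act n k (P : 'M[F]_n) (v : 'M[F]_(n, k)) := P *m map_mx tau v.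
Definition mxnorm n (P : 'M[F]_n) k := iter k (frob_act P) 1%:M.

Lemma iter_tau k x : iter k tau x = x ^+ (q ^ k).
Proof. by elim: k => [|k /= ->]; rewrite ?expn0 ?expr1 // tauE -exprM expnSr. Qed.

Lemma iter_map_tau n l k (A : 'M[F]_(n, l)) :
  iter k (map_mx tau) A = map_mx (fun x => x ^+ (q ^ k)) A.
Proof.
apply/matrixP=> i j; rewrite mxE -iter_tau.
by elim: k => //= k <-; rewrite mxE.
Qed.

Lemma iter_map_tau_id n l (A : 'M[F]_(n, l)) : iter r (map_mx tau) A = A.
Proof. by rewrite iter_map_tau; apply/matrixP=> i j; rewrite mxE -cF expf_card. Qed.

(* [mxnorm P k] is [P tau(P) ... tau^(k-1)(P)]. *)
Lemma iter_frob n l k (P : 'M[F]_n) (A : 'M[F]_(n, l)) :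
  iter k (frob_act P) A = mxnorm P k *m iter k (map_mx tau) A.
Proof.
elim: k => [|k IH]; first by rewrite /mxnorm mul1mx.
by rewrite /mxnorm !iterS IH /frob_act map_mxM mulmxA.
Qed.

Lemma det_mxnorm n (P : 'M[F]_n) k : \det (mxnorm P k) = \det P ^+ (\sum_(i < k) q ^ i).
Proof.
elim: k => [|k IH]; first by rewrite /mxnorm det1 big_ord0.
rewrite /mxnorm iterS /frob_act det_mulmx det_map_mx -/(mxnorm P k) IH tauE -exprM -exprS.
rewrite big_ord_recl expn0 add1n; congr (_ ^+ _.+1).
by rewrite big_distrl /=; apply: eq_bigr => i _; rewrite -expnSr.
Qed.

Lemma mxnormZ n (P : 'M[F]_n) k c :
  mxnorm (c *: P) k = c ^+ (\sum_(i < k) q ^ i) *: mxnorm P k.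
Proof.
elim: k => [|k IH]; first by rewrite /mxnorm big_ord0 scale1r.
rewrite /mxnorm !iterS /frob_act -!/(mxnorm _ _) IH map_mxZ tauE -scalemxAl -scalemxAr scalerA.
rewrite -exprM -exprS big_ord_recl expn0 add1n; congr (_ ^+ _.+1 *: _).
by rewrite big_distrl /=; apply: eq_bigr => i _; rewrite -expnSr.
Qed.

(** For [N = mxnorm P r] one has [P tau(N) = N tau^r(P) = N P]; for a scalar [N] this says that
    [tau] fixes it. *)
Lemma mxnorm_scalar n (P : 'M[F]_n.+1) c : P \in unitmx -> mxnorm P r = c%:M ->
  c != 0 /\ c ^+ q = c.
Proof.
move=> uP e; split.
  have : \det (mxnorm P r) != 0 by rewrite det_mxnorm expf_neq0 // -unitfE -unitmxE.
  by rewrite e; apply: contraNneq => ->; rewrite raddf0 det0.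
have h1 : frob_act P (mxnorm P r) = mxnorm P r *m P.
  have f1 : frob_act P 1%:M = P by rewrite /frob_act map_mx1 mulmx1.
  by rewrite /mxnorm -iterS iterSr f1 iter_frob iter_map_tau_id.
move: h1; rewrite /frob_act e map_scalar_mx tauE => h.
have {}h : P *m (c ^+ q)%:M = P *m c%:M by rewrite h scalar_mxC.
have := congr1 (mulmx (invmx P)) h; rewrite !mulKmx // => /matrixP/(_ 0 0).
by rewrite !mxE eqxx.
Qed.

(** Scaling [P] by [l] multiplies its norm by [l ^ m], and the norm map hits [c^-1]. *)
Lemma mxnorm_normalize n (P : 'M[F]_n.+1) c : P \in unitmx -> mxnorm P r = c%:M ->
  exists2 l, l != 0 & mxnorm (l *: P) r = 1%:M.
Proof.
move=> uP e; have [c0 cq] := mxnorm_scalar uP e.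
have : #|[set x : F | x ^+ m == c^-1]| = m.
  by apply: norm_fibre; rewrite ?invr_eq0 // exprVn cq.
move=> h; have : (0 < #|[set x : F | x ^+ m == c^-1]|)%N by rewrite h normexp_gt0.
move/card_gt0P=> [l]; rewrite inE => /eqP el; exists l.
  apply: contraNneq c0 => l0; move: el; rewrite l0 expr0n gtn_eqF ?normexp_gt0 // => /esym/eqP.
  by rewrite invr_eq0.
by rewrite mxnormZ el e scale_scalar_mx mulVf.
Qed.

(* Hilbert 90: the averages [sum_i phi^i (c w)] are fixed by [phi : v |-> P tau(v)], and by
   independence of the characters [c |-> c ^ (q ^ i)] no nonzero functional kills them all. *)
Lemma hilbert90 n (P : 'M[F]_n) : mxnorm P r = 1%:M ->
  exists2 R, R \in unitmx & P *m map_mx tau R = R.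
Proof.
move=> N1; pose phi := @frob_act n 1 P.
have phi_r v : iter r phi v = v by rewrite iter_frob N1 mul1mx iter_map_tau_id.
pose S := [set v | phi v == v].
have phiD : {morph phi : u v / u + v} by move=> u v; rewrite /phi /frob_act map_mxD mulmxDr.
have phi0 : phi 0 = 0 by rewrite /phi /frob_act map_mx0 mulmx0.
have phiZ c i v : iter i phi (c *: v) = c ^+ (q ^ i) *: iter i phi v.
  elim: i => [|i IH]; first by rewrite expn0 expr1.
  by rewrite !iterS IH /phi /frob_act map_mxZ tauE -exprM -expnSr -scalemxAr.
have avS v : \sum_(i < r) iter i phi v \in S.
  rewrite inE (big_morph phi phiD phi0).
  under eq_bigr do rewrite -iterS.
  have e : iter r.-1.+1 phi v = v by rewrite prednK.
  by rewrite -(prednK r0) big_ord_recr big_ord_recl e addrC.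
pose A := \matrix_(i < #|S|) (enum_val i)^T.
have fullA : row_full A.
  rewrite -cokermx_eq0; apply/eqP/matrixP=> k j; rewrite [RHS]mxE.
  pose f := col j (cokermx A).
  have Sf v : v \in S -> v^T *m f = 0.
    move=> vS; have := mulmx_coker A => /(congr1 (row (enum_rank_in vS v))).
    rewrite row_mul rowK enum_rankK_in // => h.
    by rewrite /f colE mulmxA h row0 mul0mx.
  pose w : 'cV[F]_n := delta_mx k 0.
  pose a i := ((iter i phi w)^T *m f) 0 0.
  (* The value of [pl] at [c] is the functional [f] on the average of the orbit of [c w], which is
     zero. The degree is below [|F|], so [pl = 0], and its coefficient at [X] is the [k]-th entry of
     [f]. *)
  pose pl := \sum_(i < r) a i *: 'X^(q ^ i).
  have spl : (size pl <= #|F|)%N.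
    apply: (leq_trans (size_sum _ _ _)); apply/bigmax_leqP=> i _.
    apply: (leq_trans (size_scale_leq _ _)); rewrite size_polyXn cF.
    by rewrite ltn_exp2l.
  have pl0 : pl = 0.
    apply/eqP; apply: contraTT spl => npl; rewrite -ltnNge cardE.
    apply: max_poly_roots; rewrite ?enum_uniq //; apply/allP=> c _.
    rewrite rootE /pl horner_sum; apply/eqP.
    transitivity (((\sum_(i < r) iter i phi (c *: w))^T *m f) 0 0); last by rewrite Sf // mxE.
    rewrite raddf_sum mulmx_suml summxE; apply: eq_bigr => i _.
    rewrite hornerZ hornerXn phiZ. by rewrite /= linearZ /= -scalemxAl mxE /a mulrC.
  have : pl`_1 = a 0%N.
    rewrite coef_sum -(prednK r0) big_ord_recl coefZ coefXn expn0 eqxx mulr1 big1 ?addr0 // => i _.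
    rewrite coefZ coefXn /= eq_sym -(expn0 q) eqn_exp2l // mulr0 //.
  rewrite pl0 coef0 /a /= /w /f => /esym; rewrite trmx_delta -rowE mxE [col _ _ _ _]mxE => ->.
  by [].
(* The columns of the witness form a basis consisting of fixed vectors. *)
exists (rowsub (fullrankfun fullA) A)^T; first by rewrite unitmx_tr fullrowsub_unit.
apply/matrixP=> i j; set k := fullrankfun fullA j.
have : enum_val k \in S := enum_valP k.
rewrite inE => /eqP /matrixP/(_ i 0); rewrite /phi /frob_act !mxE => e.
rewrite -[RHS]e; apply: eq_bigr => l _; by rewrite !mxE.
Qed.

End Frob.

(** * Bounding the number of semilinear maps *)

Lemma odd_geom_sum q n : odd (\sum_(i < n) q ^ i)%N = if odd q then odd n else (0 < n)%N.
Proof.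
elim: n => [|n IH]; first by rewrite big_ord0; case: ifP.
rewrite big_ord_recr oddD IH oddX /=; case: (odd q); rewrite ?orbT ?addbT //= orbF.
by case: n {IH}.
Qed.

(** Oddness of [m] turns [d ^ 2 = 1] and [d ^ m = 1] into [d = 1] for a determinant [d]. *)
Lemma prime_geom_sum_odd p e : prime p -> (0 < e)%N -> odd (\sum_(i < p) (p ^ e) ^ i)%N.
Proof.
move=> hp e0; rewrite odd_geom_sum oddX gtn_eqF //= (prime_gt0 hp).
by case: ifP.
Qed.

(** Cramer's rule, cleared of denominators. *)
Lemma cV2_span (F : fieldType) (x y v : 'cV[F]_2) :
  (x 0 0 * y 1 0 - x 1 0 * y 0 0) *: v =
  (v 0 0 * y 1 0 - v 1 0 * y 0 0) *: x + (x 0 0 * v 1 0 - x 1 0 * v 0 0) *: y.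
Proof. by apply: cV2P; rewrite !mxE; ring. Qed.

Lemma cV2_colinear (F : fieldType) (x y : 'cV[F]_2) : x != 0 ->
  x 0 0 * y 1 0 - x 1 0 * y 0 0 = 0 -> exists c, y = c *: x.
Proof.
move=> nx e; have [x0|x0] := eqVneq (x 0 0) 0.
  have x1 : x 1 0 != 0 by apply: contra nx => /eqP x1; apply/eqP/cV2P; rewrite mxE.
  exists (y 1 0 / x 1 0); apply: cV2P; rewrite mxE ?divfK // x0 mulr0.
  by apply: (mulfI x1); rewrite mulr0; apply: (eq_of_sub (esym e)); rewrite x0; ring.
exists (y 0 0 / x 0 0); apply: cV2P; rewrite mxE ?divfK //.
by apply: (mulfI x0); apply: (eq_of_sub e); field.
Qed.

Lemma card_scale_line (F : finFieldType) (x : 'cV[F]_2) :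
  (#|[set c *: x | c in [set~ (0%R : F)]]| <= #|F|.-1)%N.
Proof. by rewrite (leq_trans (leq_imset_card _ _)) // cardsC1. Qed.

(** There are at most two eigenlines. An eigenvector off two of them is a combination of [x] and [y]
    with nonzero coefficients, which makes all three eigenvalues equal and [A] scalar. *)
Lemma card_eigenvectors (F : finFieldType) (A : 'M[F]_2) : ~~ is_scalar_mx A ->
  (#|[set v : 'cV[F]_2 | (v != 0%R) && [exists c, A *m v == c *: v]]| <= 2 * #|F|.-1)%N.
Proof.
move=> nA; set B := [set v | _].
have line x y : x \in B -> y \in B -> x 0 0 * y 1 0 - x 1 0 * y 0 0 = 0 ->
    y \in [set c *: x | c in [set~ (0 : F)]].
  rewrite !inE => /andP[x0 _] /andP[y0 _] /(cV2_colinear x0)[c e].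
  by apply/imsetP; exists c => //; rewrite !inE; apply: contra y0 => /eqP c0; rewrite e c0 scale0r.
have [->|[x xB]] := set_0Vmem B; first by rewrite cards0.
have [sB|/subsetPn[y yB ny]] := boolP (B \subset [set c *: x | c in [set~ (0 : F)]]).
  by rewrite (leq_trans (subset_leq_card sB)) // (leq_trans (card_scale_line _)) // leq_pmull.
set L := fun x : 'cV[F]_2 => [set c *: x | c in [set~ (0 : F)]].
suff sB : B \subset L x :|: L y.
  rewrite (leq_trans (subset_leq_card sB)) // (leq_trans (leq_card_setU _ _)) //.
  by rewrite mul2n -addnn leq_add // card_scale_line.
apply/subsetP=> v vB; rewrite inE; apply/orP.
have d0 : x 0 0 * y 1 0 - x 1 0 * y 0 0 != 0 by apply: contra ny => /eqP; apply: line.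
have [b0|b0] := eqVneq (x 0 0 * v 1 0 - x 1 0 * v 0 0) 0; first by left; apply: line.
have [a0|a0] := eqVneq (v 0 0 * y 1 0 - v 1 0 * y 0 0) 0.
  by right; apply: line => //; apply: (eq_of_sub (esym a0)); ring.
have indep s t : s *: x + t *: y = 0 -> s = 0 /\ t = 0.
  move/matrixP=> e; have := e 0 0; have := e 1 0; rewrite !mxE => e1 e0.
  split; apply: (mulIf d0); rewrite mul0r.
    apply: (eq_of_sub (congr2 (fun u w => u * y 1 0 - w * y 0 0) e0 e1)); ring.
  apply: (eq_of_sub (congr2 (fun u w => u * x 0 0 - w * x 1 0) e1 e0)); ring.
move: (cV2_span x y v) d0 a0 b0; set d := _ - _; set al := _ - _; set be := _ - _ => sp d0 a0 b0.
have [c Ac] : exists c, A *m v = c *: v by move: vB; rewrite inE => /andP[_ /existsP[c /eqP]]; exists c.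
have [a Aa] : exists a, A *m x = a *: x by move: xB; rewrite inE => /andP[_ /existsP[c' /eqP]]; exists c'.
have [b Ab] : exists b, A *m y = b *: y by move: yB; rewrite inE => /andP[_ /existsP[c' /eqP]]; exists c'.
have e : (al * (c - a)) *: x + (be * (c - b)) *: y = 0.
  have : A *m (d *: v) = c *: (d *: v) by rewrite -scalemxAr Ac !scalerA mulrC.
  rewrite sp mulmxDr -!scalemxAr Aa Ab => h; apply/esym/(eq_of_sub h).
  by apply: cV2P; rewrite !mxE; ring.
have [/eqP ea /eqP eb] := indep _ _ e.
move: ea eb; rewrite !mulf_eq0 (negPf a0) (negPf b0) /= !subr_eq0 => /eqP ea /eqP eb; subst a b.
case/negP: nA; apply/is_scalar_mxP; exists c.
have Aw (w : 'cV[F]_2) : A *m w = c *: w.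
  have spw := cV2_span x y w; rewrite -/d in spw.
  apply: (scalerI d0); rewrite scalemxAr spw mulmxDr -!scalemxAr Aa Ab.
  by rewrite [d *: (c *: w)]scalerA (mulrC d c) -scalerA spw scalerDr !scalerA ![_ * c]mulrC.
apply/matrixP=> i j; have := Aw (delta_mx j 0) => /matrixP/(_ i 0).
by rewrite -colE !mxE eqxx andbT mulr_natr.
Qed.

(** * Counting matrices of norm 1 through their fixed vectors *)

Section FrobeniusClass.
Variables (F : finFieldType) (p f : nat) (tau : {rmorphism F -> F}).
Hypotheses (hp : prime p) (f0 : (0 < f)%N) (cF : #|F| = ((p ^ f) ^ p)%N).
Hypothesis tauE : forall x, tau x = x ^+ (p ^ f).
Let q := (p ^ f)%N.
Let m := (\sum_(i < p) q ^ i)%N.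
Let q1 : (1 < q)%N. Proof. by rewrite -(exp1n f) ltn_exp2r // prime_gt1. Qed.
Let p0 : (0 < p)%N := prime_gt0 hp.
Let m0 : (0 < m)%N := normexp_gt0 q p0.

(** The matrix [R] of Hilbert 90 carries the [tau]-fixed vectors to vectors fixed by [P tau]. *)
Lemma card_frob_fixed (P : 'M[F]_2) : mxnorm tau P p = 1%:M ->
  (q ^ 2 - 1 <= #|[set v : 'cV[F]_2 | (v != 0%R) && (frob_act tau P v == v)]|)%N.
Proof.
move=> N1; have [R uR PR] := hilbert90 q1 p0 cF tauE N1.
pose S := [set v : 'cV[F]_2 | frob_act tau P v == v].
have cS : (q ^ 2 <= #|S|)%N.
  apply: leq_trans (card_fixed_cV2 q1 p0 cF tauE) _.
  rewrite -(card_imset (f := mulmx R)); last exact: (can_inj (mulKmx uR)).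
  apply/subset_leq_card/subsetP=> _ /imsetP[z zS ->].
  by move: zS; rewrite !inE => /eqP tz; rewrite /frob_act map_mxM tz mulmxA PR.
rewrite leq_subLR; apply: leq_trans cS _; rewrite (cardsD1 0 S).
have -> : [set v | (v != 0%R) && (frob_act tau P v == v)] = S :\ 0.
  by apply/setP=> v; rewrite !inE.
by rewrite leq_add2r; case: (_ \in _).
Qed.

Variables (G : {group {'GL_2[F]}}) (D : {set 'M[F]_2}).
Hypotheses (coGp : coprime #|G| p) (sZG : GLscalar F \subset G).
Hypothesis normD : {in D, forall P, mxnorm tau P p = 1%:M}.
Hypothesis diffD : {in D &, forall P P', exists2 g, g \in G & GLval g *m P' = P}.
Let Z := GLscalar_group F.
Let pF : p \in [pchar F]. Proof. by apply: (@card_finPcharP _ _ (f * p)); rewrite // expnM. Qed.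

Let unitD P : P \in D -> P \in unitmx.
Proof.
move/normD=> N1; rewrite unitmxE unitfE; apply/negP=> /eqP d0.
have := det_mxnorm tauE P p; rewrite N1 det1 d0 expr0n gtn_eqF //= => /eqP.
by rewrite oner_eq0.
Qed.

Let det_normD P : P \in D -> \det P ^+ m = 1.
Proof. by move/normD=> N1; rewrite -(det_mxnorm tauE) N1 det1. Qed.

Let Rv (v : 'cV[F]_2) := [set P in D | frob_act tau P v == v].

Let diffRv v P P' : P \in Rv v -> P' \in Rv v ->
  exists g, [/\ g \in G, GLval g *m P' = P & GLval g *m v = v].
Proof.
rewrite !inE => /andP[PD /eqP Pv] /andP[PD' /eqP Pv'].
have [g gG e] := diffD PD PD'; exists g; split=> //.
by rewrite -{1}Pv' /frob_act mulmxA e.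
Qed.

(** Two members of [Rv v] with the same determinant differ by an element of [G] that fixes [v] and
    has determinant 1, so they are equal. The determinants are roots of [X ^ m - 1]. *)
Let card_Rv v : v != 0 -> (#|Rv v| <= m)%N.
Proof.
move=> v0; rewrite -(card_in_imset (f := fun P : 'M[F]_2 => \det P)).
  apply: leq_trans (card_roots_Xn 1 m0).
  apply/subset_leq_card/subsetP=> _ /imsetP[P PR ->].
  by move: PR; rewrite !inE => /andP[PD _]; rewrite det_normD.
move=> P P' PR PR' dP; have [g [gG e gv]] := diffRv PR PR'.
have g1 : g = 1%g.
  apply: (unipotent1 pF coGp v0 gG gv).
  have PD' : P' \in D by move: PR'; rewrite inE => /andP[].
  have d0 : \det P' != 0 by rewrite -unitfE -unitmxE unitD.
  by apply: (mulIf d0); rewrite -det_mulmx e mul1r.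
by rewrite -e g1 GL_1E mul1mx.
Qed.

(** The quotient [g] of two members fixes [v] and has a scalar square, so [g ^ 2 = 1]. Its
    determinant satisfies [d ^ 2 = d ^ m = 1], hence is 1 because [m] is odd, and [g = 1]. *)
Let card_Rv_small v : v != 0 -> (#|line_stab G v| < 3 * #|Z|)%N -> (#|Rv v| <= 1)%N.
Proof.
move=> v0 small; apply/card_le1P=> P PR P'; rewrite [RHS]inE; apply/idP/eqP=> [PR'|-> //].
have [g [gG e gv]] := diffRv PR' PR.
have gL : g \in line_stab G v by rewrite inE gG; apply/existsP; exists 1; rewrite gv scale1r.
have := line_stab_small sZG gL small.
rewrite inE GL_valX => /is_scalar_mxP[c ec].
have c1 : c = 1.
  have : GLval g ^+ 2 *m v = v by rewrite expr2 -mulmxA !gv.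
  move/eqP; rewrite ec mul_scalar_mx -subr_eq0 -{2}[v]scale1r -scalerBl scaler_eq0 (negPf v0).
  by rewrite orbF subr_eq0 => /eqP.
have d2 : \det (GLval g) ^+ 2 = 1.
  by rewrite expr2 -det_mulmx -[_ *m _]/(GLval g * GLval g) -expr2 ec c1 det1.
have PD : P \in D by move: PR; rewrite inE => /andP[].
have PD' : P' \in D by move: PR'; rewrite inE => /andP[].
have dm : \det (GLval g) ^+ m = 1.
  by have := det_normD PD'; rewrite -e det_mulmx exprMn (det_normD PD) mulr1.
have d1 : \det (GLval g) = 1.
  move: dm; rewrite -(odd_double_half m) (prime_geom_sum_odd hp f0) exprS -mul2n exprM d2.
  by rewrite expr1n mulr1.
have g1 := unipotent1 pF coGp v0 gG gv d1.
by rewrite -e g1 GL_1E mul1mx.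
Qed.
Let sum_Rv : (#|D| * (q ^ 2 - 1) <= \sum_(v : 'cV[F]_2 | v != 0%R) #|Rv v|)%N.
Proof.
rewrite -sum_nat_const.
apply: (@leq_trans (\sum_(P in D) \sum_(v : 'cV[F]_2 | v != 0%R) (frob_act tau P v == v))).
  apply: leq_sum => P PD; apply: leq_trans (card_frob_fixed (normD PD)) _.
  rewrite -sum1_card big_mkcond [X in (_ <= X)%N]big_mkcond /=; apply: leq_sum => v _.
  by rewrite inE; case: (v != 0); case: (frob_act _ _ _ == _).
rewrite exchange_big /=; apply: leq_sum => v _.
rewrite -sum1_card big_mkcond [X in (_ <= X)%N]big_mkcond /=; apply: leq_sum => P _.
by rewrite inE; case: (P \in D); case: (frob_act _ _ _ == _).
Qed.

Let special := [set v : 'cV[F]_2 | (v != 0%R) && (3 * #|Z| <= #|line_stab G v|)%N].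

Let line_stab_nonscalar v : v \in special -> exists2 x, x \in line_stab G v & x \in G :\: Z.
Proof.
rewrite inE => /andP[v0 lt3].
have /subsetPn[x xL xZ] : ~~ (line_stab G v \subset Z).
  apply/negP=> /subset_leq_card; apply/negP; rewrite -ltnNge.
  by apply: leq_trans lt3; rewrite ltn_Pmull ?cardG_gt0.
exists x => //; rewrite inE xZ; move: xL; rewrite inE => /andP[->] //.
Qed.

(** A nonscalar element stabilizing a special line has a large centralizer. All large centralizers
    being equal, any two such elements commute, so every special vector is an eigenvector of one
    fixed [x]. *)
Let card_special :
  {in G :\: Z &, forall x y, (3 * #|Z| <= #|'C_G[x]%g|)%N -> (3 * #|Z| <= #|'C_G[y]%g|)%N ->
     'C_G[x]%g = 'C_G[y]%g} -> (#|special| <= 2 * #|F|.-1)%N.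
Proof.
move=> hC; have [->|[v vS]] := set_0Vmem special; first by rewrite cards0.
have big u x : u \in special -> x \in line_stab G u -> (3 * #|Z| <= #|'C_G[x]%g|)%N.
  rewrite inE => /andP[u0 h] xu; apply: (leq_trans h).
  by apply: subset_leq_card; apply: (line_stab_cent pF).
have [x xL xGZ] := line_stab_nonscalar vS.
have nx : ~~ is_scalar_mx (GLval x) by case/setDP: xGZ => _; rewrite inE.
apply: leq_trans (card_eigenvectors nx); apply/subset_leq_card/subsetP=> u uS.
have [y yL yGZ] := line_stab_nonscalar uS.
have ny : ~~ is_scalar_mx (GLval y) by case/setDP: yGZ => _; rewrite inE.
have eC := hC x y xGZ yGZ (big _ _ vS xL) (big _ _ uS yL).
have /setIP[_ /cent1P/GL_commuteE yx] : (x \in 'C_G[y])%g.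
  by rewrite -eC inE cent1id andbT; case/setDP: xGZ.
rewrite inE; have u0 : u != 0 by move: uS; rewrite inE => /andP[].
rewrite u0; have [a [b ->]] := mx2_comm ny (esym yx).
move: yL; rewrite inE => /andP[_ /existsP[c /eqP ec]]; apply/existsP; exists (a + b * c).
by rewrite mulmxDl mul_scalar_mx -scalemxAl ec scalerA scalerDl.
Qed.

Let card_D_special : (#|special| <= 2 * #|F|.-1)%N -> (#|D| <= m * m)%N.
Proof.
move=> cS; pose Q := #|F|.
have Q1 : (1 < Q)%N by rewrite /Q cF -(exp1n p) ltn_exp2r.
have cV : #|[set v : 'cV[F]_2 | v != 0%R]| = (Q ^ 2 - 1)%N.
  have -> : [set v : 'cV[F]_2 | v != 0%R] = [set~ 0%R] by apply/setP=> v; rewrite !inE.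
  by rewrite cardsC1 card_mx muln1 subn1.
have le1 : (\sum_(v : 'cV[F]_2 | v != 0%R) #|Rv v| <=
    \sum_(v : 'cV[F]_2 | v != 0%R) (1 + (v \in special) * m.-1))%N.
  apply: leq_sum => v v0; case vS: (v \in special).
    by rewrite mul1n add1n prednK //; apply: card_Rv.
  rewrite mul0n addn0; apply: card_Rv_small => //.
  by move: vS; rewrite inE v0 /= ltnNge => ->.
have e2 : (\sum_(v : 'cV[F]_2 | v != 0%R) (1 + (v \in special) * m.-1) =
    (Q ^ 2 - 1) + #|special| * m.-1)%N.
  rewrite big_split /= -cV -sum1_card; congr addn.
    by apply: eq_bigl => v; rewrite inE.
  rewrite -big_distrl /=; congr muln; rewrite -sum1_card big_mkcond [RHS]big_mkcond /=.
  by apply: eq_bigr => v _; rewrite inE; case: (v != 0); case: (_ <= _)%N.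
have := leq_trans sum_Rv le1; rewrite e2 => h.
have {}h : (#|D| * (q ^ 2 - 1) <= (Q ^ 2 - 1) + 2 * Q.-1 * m.-1)%N.
  by apply: leq_trans h _; rewrite leq_add2l leq_mul2r cS orbT.
have eQ : Q.-1 = (q.-1 * m)%N := normexpE cF.
have [k ek] : exists k, m = k.+1 by exists m.-1; rewrite prednK.
have [j ej] : exists j, q = j.+2 by exists q.-2; move: q1; case: (q) => [|[]].
have [i ei] : exists i, Q = i.+2 by exists Q.-2; move: Q1; case: (Q) => [|[]].
move: h eQ; rewrite ek ej ei /= => h eQ.
(* With [Q - 1 = (q - 1) m], the bound [(Q^2 - 1) + 2 (Q - 1) (m - 1)] is exactly
   [m^2 (q^2 - 1)]. *)
have eR : ((i.+2 ^ 2 - 1) + 2 * i.+1 * k = (k.+1 * k.+1) * (j.+2 ^ 2 - 1))%N.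
  have -> : (i.+2 ^ 2 - 1 = i.+1 * (i.+1 + 2))%N by rewrite -mulnn; lia.
  have -> : (j.+2 ^ 2 - 1 = j.+1 * (j.+1 + 2))%N by rewrite -mulnn; lia.
  by rewrite eQ; lia.
by rewrite eR leq_pmul2r // in h; rewrite -mulnn; lia.
Qed.

(** Fix [P0] in [D] and send [P = g P0] to the coset of [g] modulo [Z]. Matrices with the same coset
    differ by a scalar, whose [m]-th power is 1 because both norms are 1. *)
Let card_D_index : (#|D| <= #|G : Z|%g * m)%N.
Proof.
have [->|[P0 P0D]] := set_0Vmem D; first by rewrite cards0.
pose g P := odflt 1%g [pick g in G | GLval g *m P0 == P].
have gP P : P \in D -> g P \in G /\ GLval (g P) *m P0 = P.
  move=> PD; rewrite /g; case: pickP => [x /andP[xG /eqP e] //|].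
  by have [x xG e] := diffD PD P0D; move/(_ x); rewrite xG e eqxx.
rewrite -sum1_card (partition_big (fun P => (Z :* g P)%g) (mem (rcosets Z G))) /=; last first.
  by move=> P PD; apply/rcosetsP; exists (g P) => //; case: (gP P PD).
rewrite -sum_nat_const; apply: leq_sum => C _; rewrite sum1_card.
set S := fun P => _; have [P PS|S0] := pickP S; last by rewrite eq_card0.
move: (PS) => /andP[PD /eqP eP].
apply: (@leq_trans #|[set c *: P | c in [set c : F | c ^+ m == 1%R]]|); last first.
  by rewrite (leq_trans (leq_imset_card _ _)) // card_roots_Xn.
apply/subset_leq_card/subsetP=> P' /andP[PD' /eqP eP'].
have : g P' \in (Z :* g P)%g by rewrite eP -eP' rcoset_refl.
case/rcosetP=> z; rewrite inE => /is_scalar_mxP[c ec] eg.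
have eP2 : P' = c *: P.
  have [_ <-] := gP P' PD'; rewrite eg GL_MxE ec -mulmxA mul_scalar_mx.
  by have [_ ->] := gP P PD.
apply/imsetP; exists c => //; rewrite inE.
have := normD PD'; rewrite eP2 (mxnormZ tauE) normD // => /matrixP/(_ 0 0).
by rewrite !mxE mulr1 => ->.
Qed.

Lemma card_frob_class : (#|D| <= m * m)%N.
Proof.
have [hC|[h60 hodd h3]] := primeto_dichotomy pF coGp sZG.
  exact/card_D_special/card_special.
(* It remains to see that [|G : Z| <= m]. As [|G|] is even, [p] is not 2. If [p = 3], then 3 does
   not divide [|G|] and [|G : Z| <= 10 < 1 + 3 + 9 <= m]. If [p >= 5], then [|G : Z| <= 60 < 5 ^ 4
   <= q ^ (p - 1) <= m]. *)
apply: (leq_trans card_D_index); rewrite leq_mul2r; apply/orP; right.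
have cG : (#|Z| * #|G : Z|%g = #|G|)%N by apply: Lagrange.
have Z0 : (0 < #|Z|)%N := cardG_gt0 Z.
have qp : (p <= q)%N by rewrite -{1}(expn1 p) leq_exp2l // prime_gt1.
have mq : (q ^ p.-1 <= m)%N.
  by rewrite /m -(prednK p0) big_ord_recr leq_addl.
have [p2|p2] := eqVneq p 2%N.
  by move: coGp; rewrite p2 coprime_sym prime_coprime // dvdn2 hodd.
have [p3|p3] := eqVneq p 3%N.
  have m13 : (13 <= m)%N.
    have q3 : (3 <= q)%N by rewrite -{1}p3.
    by rewrite /m p3 !big_ord_recr big_ord0 /= expn0 expn1 -mulnn; clear -q3; nia.
  have {}h3 : (#|G| <= 10 * #|Z|)%N.
    by case: h3 => //; move: coGp; rewrite p3 coprime_sym prime_coprime // => /negPf ->.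
  by move: h3; rewrite -cG mulnC leq_pmul2r // => /leq_trans; apply; lia.
have p5 : (5 <= p)%N.
  by move: hp p2 p3; case: (p) => [|[|[|[|[|]]]]].
have m60 : (60 <= m)%N.
  apply: leq_trans mq; apply: (@leq_trans (5 ^ 4)) => //.
  apply: (@leq_trans (5 ^ p.-1)); first by rewrite leq_exp2l //; lia.
  by rewrite leq_exp2r ?(leq_trans p5) //; lia.
by move: h60; rewrite -cG mulnC leq_pmul2r // => /leq_trans; apply.
Qed.
End FrobeniusClass.

(** * Covering the invertible matrices by fixed points of pairs *)

Lemma mx2_central (F : fieldType) (A : 'M[F]_2) : (forall Y, A *m Y = Y *m A) -> is_scalar_mx A.
Proof.
move=> h; apply/is_scalar_mxP; exists (A 0 0).
have /matrixP h1 := h (delta_mx 0 1); have /matrixP h2 := h (delta_mx 1 0).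
have := h1 0 0; have := h1 0 1; have := h2 0 0.
rewrite !(mxE, sum2E) /= !mulr0n !mulr1n !mulr0 !mul0r !addr0 !add0r !mul1r !mulr1.
move=> e01 e00 e10; apply: mx2P; rewrite !mxE /= ?mulr1n ?mulr0n //.
Qed.

(** Taking [Y = 1] shows that [B^T] inverts [A]; then [A] is central. *)
Lemma mx2_two_sided (F : fieldType) (A B : 'M[F]_2) : (forall Y, A *m Y *m B^T = Y) ->
  exists2 c, c != 0 & A = c%:M /\ B = (c^-1)%:M.
Proof.
move=> h; have AB : A *m B^T = 1%:M by rewrite -[RHS](h 1%:M) mulmx1.
have BA := mulmx1C AB.
have /is_scalar_mxP[c ec] : is_scalar_mx A.
  by apply: mx2_central => Y; rewrite -{2}(h Y) -[in RHS]mulmxA BA mulmx1.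
have c0 : c != 0.
  apply/eqP=> c0; move: AB; rewrite ec c0 raddf0 mul0mx => /matrixP/(_ 0 0).
  by rewrite !mxE /= => /eqP; rewrite eq_sym oner_eq0.
exists c => //; split=> //; apply: trmx_inj; rewrite tr_scalar_mx.
by rewrite -[RHS]scalemx1 -AB ec mul_scalar_mx scalerA mulVf // scale1r.
Qed.

Lemma card_unitmx2 (F : finFieldType) :
  (#|F| * #|F|.-1 ^ 2 * #|F|.+1 <= #|[set M : 'M[F]_2 | M \in unitmx]|)%N.
Proof.
rewrite -card_GL_2 -(card_imset _ (@GL_inj F)).
by apply/subset_leq_card/subsetP=> _ /imsetP[u _ ->]; rewrite inE; exact: (GL_unitmx u).
Qed.

(** After cancellation the inequality becomes [s (Q + 1) (q - 1) <= (Q - 1) (q + 1)], which is false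
    as soon as [q + 1 <= (q - 1) s]. The only remaining case is [q = s = 2], where it reads
    [10 <= 9]. *)
Lemma cover_arith (q s m Q : nat) : (1 < q)%N -> (q <= s)%N -> Q = (q * s)%N ->
  Q.-1 = (q.-1 * m)%N ->
  ~ (Q * Q.-1 ^ 2 * Q.+1 * m <= (m * m) * (m * m) * ((q ^ 2 - 1) * (q ^ 2 - q)))%N.
Proof.
move=> q1 qs eQ em.
have [j ej] : exists j, q = j.+2 by exists q.-2; case: (q) q1 => [|[]].
have m0 : (0 < m)%N by case: m em => // em; move: em; rewrite muln0 eQ; nia.
have e1 : (q ^ 2 - 1 = q.-1 * q.+1)%N by rewrite ej -mulnn /=; lia.
have e2 : (q ^ 2 - q = q.-1 * q)%N by rewrite ej -mulnn /=; lia.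
have -> : (Q * Q.-1 ^ 2 * Q.+1 * m = (m * m * m * q.-1 * q.-1) * (Q * Q.+1))%N.
  by rewrite em -mulnn; lia.
have -> : ((m * m) * (m * m) * ((q ^ 2 - 1) * (q ^ 2 - q)) =
   (m * m * m * q.-1 * q.-1) * (m * (q.+1 * q)))%N by rewrite e1 e2; lia.
have q10 : (0 < q.-1)%N by rewrite ej.
rewrite leq_pmul2l ?muln_gt0 ?m0 ?q10 //.
have -> : (Q * Q.+1 = q * (s * Q.+1))%N by rewrite {1}eQ mulnA.
have -> : (m * (q.+1 * q) = q * (m * q.+1))%N by rewrite mulnA mulnC.
rewrite leq_pmul2l ?(ltnW q1) // => h; have {}h : (s * Q.+1 * q.-1 <= Q.-1 * q.+1)%N.
  by rewrite em -[(q.-1 * m * _)%N]mulnA [X in (X <= _)%N]mulnC leq_mul2l h orbT.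
have s0 : (0 < s)%N by apply: leq_trans qs; rewrite ltnW.
have [h1|h1] := leqP q.+1 (q.-1 * s).
  have : (s * Q.+1 * q.-1 <= Q.-1 * (q.-1 * s))%N.
    by apply: leq_trans h _; rewrite leq_mul2l h1 orbT.
  have -> : (s * Q.+1 * q.-1 = Q.+1 * (q.-1 * s))%N by rewrite mulnAC mulnC [(s * _)%N]mulnC.
  by rewrite leq_pmul2r ?muln_gt0 ?q10 //; lia.
have j0 : j = 0%N.
  have : (j.+1 * j.+2 <= 1 * j.+2)%N.
    have h2 : (j.+1 * j.+2 <= q.-1 * s)%N by rewrite ej leq_mul2l -ej qs orbT.
    by have := leq_ltn_trans h2 h1; rewrite ej ltnS mul1n.
  by rewrite leq_pmul2r // ltnS leqn0 => /eqP.
have s2 : s = 2%N by move: h1 qs; rewrite ej j0 /= mul1n; clear; lia.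
by move: h; rewrite eQ s2 ej j0.
Qed.

Section Cover.
Variables (F : finFieldType) (p f : nat) (tau : {rmorphism F -> F}).
Hypotheses (hp : prime p) (f0 : (0 < f)%N) (cF : #|F| = ((p ^ f) ^ p)%N).
Hypothesis tauE : forall x, tau x = x ^+ (p ^ f).
Let q := (p ^ f)%N.
Let m := (\sum_(i < p) q ^ i)%N.
Let q1 : (1 < q)%N. Proof. by rewrite -(exp1n f) ltn_exp2r // prime_gt1. Qed.
Let p0 : (0 < p)%N := prime_gt0 hp.

(** If [A] and [B] are the Hilbert 90 matrices of [P] and [R], the solutions are [M = A N B^T] with
    [N] invertible and fixed by [tau]. *)
Lemma card_fixed_pair (P R : 'M[F]_2) : mxnorm tau P p = 1%:M -> mxnorm tau R p = 1%:M ->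
  (#|[set M : 'M[F]_2 | (M \in unitmx) && (P *m map_mx tau M *m R^T == M)]|
     <= (q ^ 2 - 1) * (q ^ 2 - q))%N.
Proof.
move=> /(hilbert90 q1 p0 cF tauE)[A uA eA] /(hilbert90 q1 p0 cF tauE)[B uB eB].
apply: leq_trans (card_fixed_GL2 q1 p0 cF tauE).
have uAt : map_mx tau A \in unitmx by rewrite map_unitmx.
have uBt : map_mx tau B \in unitmx by rewrite map_unitmx.
have eP : P = A *m invmx (map_mx tau A) by rewrite -{1}eA mulmxK.
have eR : R = B *m invmx (map_mx tau B) by rewrite -{1}eB mulmxK.
pose g (M : 'M[F]_2) := invmx A *m M *m (invmx B)^T.
have gI : injective g.
  move=> M M' /(congr1 (fun X => A *m X *m B^T)); rewrite /g !mulmxA !mulmxV // !mul1mx.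
  by rewrite -!mulmxA -!trmx_mul !mulmxV // trmx1 !mulmx1.
rewrite -(card_imset _ gI); apply/subset_leq_card/subsetP=> X /imsetP[M MS ->].
move: MS; rewrite !inE => /andP[uM /eqP eM]; rewrite /g.
rewrite !unitmx_mul unitmx_tr !unitmx_inv uA uB uM /=; apply/eqP.
rewrite !map_mxM -map_trmx !map_invmx -[in RHS]eM eP eR trmx_mul.
by rewrite !mulmxA mulVmx // mul1mx -!mulmxA -trmx_mul mulVmx // trmx1 mulmx1.
Qed.

Variable S : 'M[F]_2 -> 'M[F]_2 -> bool.
Hypothesis SZ : forall P R c, S P R -> c != 0 -> S (c *: P) (c^-1 *: R).
Let D1 := [set P | (mxnorm tau P p == 1%:M) && [exists R, S P R]].
Let D2 := [set R | (mxnorm tau R p == 1%:M) && [exists P, S P R]].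

(** Double count of the incidences between invertible [M] and pairs fixing them. The factor [m] on
    the left arises because a pair [(P, R)] fixing [M] yields the [m] pairs [(c P, c^-1 R)] with
    [c ^ m = 1]. *)
Lemma card_cover : (forall M : 'M[F]_2, M \in unitmx -> exists P R,
     [/\ P \in D1, R \in D2, S P R & P *m map_mx tau M *m R^T = M]) ->
  (#|F| * #|F|.-1 ^ 2 * #|F|.+1 * m <= #|D1| * #|D2| * ((q ^ 2 - 1) * (q ^ 2 - q)))%N.
Proof.
move=> cov.
apply: (@leq_trans (#|[set M : 'M[F]_2 | M \in unitmx]| * m)).
  by rewrite leq_mul2r card_unitmx2 orbT.
rewrite -cardsX -!sum_nat_const.
pose fx (x : 'M[F]_2 * 'M[F]_2) M := x.1 *m map_mx tau M *m x.2^T == M.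
apply: (@leq_trans (\sum_(M in [set M : 'M[F]_2 | M \in unitmx]) \sum_(x in setX D1 D2) fx x M)).
  apply: leq_sum => M; rewrite inE => uM; have [P [R [PD RD PR eM]]] := cov M uM.
  have cm1 : #|[set x : F | x ^+ m == 1]| = m := norm_fibre q1 p0 cF (oner_neq0 F) (expr1n _ _).
  rewrite -{1}cm1.
  pose g (c : F) := (c *: P, c^-1 *: R).
  have P0 : P != 0.
    apply: contraTneq uM => P0; rewrite -eM P0 !mul0mx.
    by rewrite unitmxE det0 unitr0.
  have gI : injective g.
    move=> c d [/eqP]; rewrite -subr_eq0 -scalerBl scaler_eq0 (negPf P0) orbF subr_eq0.
    by move=> /eqP.
  rewrite -(card_imset _ gI) -sum1_card.
  rewrite big_mkcond [X in (_ <= X)%N]big_mkcond /=; apply: leq_sum => x _.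
  case: imsetP => // -[c cm ->]; move: cm; rewrite inE => /eqP cm.
  have c0 : c != 0.
    apply/eqP=> c0; move/eqP: cm; rewrite c0 expr0n gtn_eqF ?normexp_gt0 //.
    by rewrite eq_sym oner_eq0.
  move: PD RD; rewrite !inE /= => /andP[/eqP NP _] /andP[/eqP NR _].
  rewrite !(mxnormZ tauE) NP NR exprVn -/q -/m cm invr1 !scale1r eqxx /=.
  have Sc := SZ PR c0.
  have s1 : [exists R0, S (c *: P) R0] by apply/existsP; exists (c^-1 *: R).
  have s2 : [exists P0, S P0 (c^-1 *: R)] by apply/existsP; exists (c *: P).
  rewrite s1 s2 /fx /=.
  by rewrite linearZ /= -!scalemxAl -!scalemxAr scalerA mulfV // scale1r eM eqxx.
rewrite exchange_big /=; apply: leq_sum => -[P R]; rewrite !inE /=.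
move=> /andP[/andP[/eqP NP _] /andP[/eqP NR _]]; apply: leq_trans (card_fixed_pair NP NR).
rewrite -sum1_card big_mkcond [X in (_ <= X)%N]big_mkcond /=; apply: leq_sum => M _.
by rewrite !inE /fx /=; case: (M \in unitmx); case: (_ == _).
Qed.
End Cover.

(** Keeping [L] and [S] abstract lets one statement serve both tensor factors. The first components
    of [L] form the group [G] of [card_frob_class]. An element of [G] of order [p] would have a
    scalar [n]-th power [c] with [c ^ p = 1], hence [c = 1], and [p] would divide [n]. *)
Lemma card_semilinear_parts (F : finFieldType) (p f : nat) (tau : {rmorphism F -> F}) (n : nat)
    (L : {'GL_2[F]} -> {'GL_2[F]} -> bool) (S : 'M[F]_2 -> 'M[F]_2 -> bool) :
  prime p -> (0 < f)%N -> #|F| = ((p ^ f) ^ p)%N -> (forall x, tau x = x ^+ (p ^ f)) ->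
  coprime n p ->
  (forall z, z \in GLscalar F -> exists w, L z w) ->
  (forall u w u' w', L u w -> L u' w' -> L (u * u')%g (w * w')%g) ->
  (forall u w, L u w -> is_scalar_mx (GLval u ^+ n)) ->
  (forall P R P' R', S P R -> S P' R' -> exists u w, L u w /\ GLval u *m P' = P) ->
  (#|[set P | (mxnorm tau P p == 1%:M) && [exists R, S P R]]| <=
    (\sum_(i < p) (p ^ f) ^ i) * (\sum_(i < p) (p ^ f) ^ i))%N.
Proof.
move=> hp f0 cF tauE con Lz LM Ln LS.
have pF : p \in [pchar F] by apply: (@card_finPcharP _ _ (f * p)); rewrite // expnM.
have gG : group_set [set u | [exists w, L u w]].
  apply/group_setP; split=> [|u u'].
    rewrite inE; have [w Lw] := Lz 1%g (group1 (GLscalar_group F)).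
    by apply/existsP; exists w.
  rewrite !inE => /existsP[w Lw] /existsP[w' Lw']; apply/existsP; exists (w * w')%g.
  exact: LM.
pose G := Group gG.
apply: (card_frob_class hp f0 cF tauE (G := G)).
- rewrite coprime_sym prime_coprime //; apply/negP=> /(Cauchy hp)[u uG ou].
  move: uG; rewrite inE => /existsP[w /Ln /is_scalar_mxP[c ec]].
  have up : (u ^+ p = 1)%g by rewrite -ou expg_order.
  have c1 : c ^+ p = 1.
    have : (c ^+ p)%:M = 1%:M :> 'M[F]_2.
      by rewrite (rmorphXn (@scalar_mx F 2)) /= -ec -exprM mulnC exprM -GL_valX up GL_1E expr1n.
    by move/matrixP/(_ 0 0); rewrite !mxE.
  have {}c1 : c = 1.
    apply/eqP; rewrite -subr_eq0; have : (c - 1) ^+ p = 0.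
      by rewrite -(pFrobenius_autE pF) rmorphB rmorph1 /= pFrobenius_autE c1 subrr.
    by move/eqP; rewrite expf_eq0 => /andP[].
  have un : (u ^+ n = 1)%g by apply: GL_inj; rewrite GL_valX ec c1 GL_1E.
  have : (p %| n)%N by rewrite -ou order_dvdn un.
  by apply/negP; rewrite -prime_coprime // coprime_sym.
- by apply/subsetP=> z /Lz[w Lw]; rewrite inE; apply/existsP; exists w.
- by move=> P; rewrite inE => /andP[/eqP].
- move=> P P'; rewrite !inE => /andP[_ /existsP[R PR]] /andP[_ /existsP[R' PR']].
  have [u [w [Lu e]]] := LS _ _ _ _ PR PR'.
  by exists u => //; rewrite inE; apply/existsP; exists w.
Qed.

(** * Reduction to 2 x 2 matrices *)

Lemma frob_iter_rmorphism (F : finFieldType) (p k : nat) : p \in [pchar F] ->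
  exists phi : {rmorphism F -> F}, forall x, phi x = x ^+ (p ^ k).
Proof.
move=> pF; elim: k => [|k [phi IH]]; first by exists idfun => x; rewrite expn0 expr1.
exists (phi \o pFrobenius_aut pF) => x /=.
by rewrite IH pFrobenius_autE -exprM expnS.
Qed.

(** With [l] reduced to [r] modulo [n], a nonzero [r] would give [X^(p^r) - X] more roots than its
    degree. *)
Lemma frob_period (F : finFieldType) (p n l : nat) : (1 < p)%N -> #|F| = (p ^ n)%N ->
  (forall c : F, c ^+ (p ^ l) = c) -> (n %| l)%N.
Proof.
move=> p1 cF h.
have n0 : (0 < n)%N by case: n cF => // cF; have := finNzRing_gt1 F; rewrite cF.
have cyc (c : F) j : c ^+ (p ^ (n * j)) = c.
  by elim: j => [|j IH]; rewrite ?muln0 ?expr1 // mulnS expnD exprM -cF expf_card.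
have hr (c : F) : c ^+ (p ^ (l %% n)) = c.
  by rewrite -{2}(h c) {2}(divn_eq l n) expnD exprM mulnC cyc.
rewrite /dvdn eqn0Ngt; apply/negP=> r0; move: hr (ltn_pmod l n0); move: (l %% n)%N r0 => r r0 hr rn.
have sz : size ('X^(p ^ r) - 'X : {poly F}) = (p ^ r).+1.
  rewrite size_polyDl ?size_polyXn // size_polyN size_polyX ltnS.
  by apply: (leq_trans p1); rewrite -{1}(expn1 p) leq_exp2l.
have : (size (enum F) < size ('X^(p ^ r) - 'X : {poly F})%R)%N.
  apply: max_poly_roots; rewrite ?enum_uniq //; first by rewrite -size_poly_eq0 sz.
  by apply/allP=> c _; rewrite rootE !hornerE hr subrr.
by rewrite sz -cardE cF ltnS leq_exp2l // leqNgt rn.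
Qed.

(** * The elements of the tensor stabilizer as semilinear maps *)

Section NormalForm.
Variables (F : finFieldType) (a b p : nat).
Hypothesis pF : p \in [pchar F].

(** The exponent [k] is a natural number, not a residue modulo the degree of [F], so that it adds up
    under products. *)
Definition tensor_semilinear (s : {perm 'M[F]_(a, b)}) (k : nat) : Prop :=
  exists (phi : {rmorphism F -> F}) (P : 'M[F]_a) (Q : 'M[F]_b),
  [/\ forall x, phi x = x ^+ (p ^ k), P \in unitmx, Q \in unitmx
    & forall X, s X = P *m map_mx phi X *m Q].

Lemma tensor_semilinear1 : tensor_semilinear 1%g 0.
Proof.
exists idfun, 1%:M, 1%:M; split; rewrite ?unitmx1 // => X.
by rewrite perm1 mul1mx mulmx1 map_mx_id.
Qed.

Lemma tensor_semilinearM s t k l : tensor_semilinear s k -> tensor_semilinear t l ->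
  tensor_semilinear (s * t)%g (k + l).
Proof.
move=> [phi [P [Q [hphi uP uQ hs]]]] [psi [P' [Q' [hpsi uP' uQ' ht]]]].
exists (psi \o phi), (P' *m map_mx psi P), (map_mx psi Q *m Q'); split.
- by move=> x /=; rewrite hpsi hphi -exprM expnD.
- by rewrite unitmx_mul uP' map_unitmx.
- by rewrite unitmx_mul uQ' map_unitmx uQ.
- move=> X; have -> : map_mx (psi \o phi) X = map_mx psi (map_mx phi X).
    by apply/matrixP=> i j; rewrite !mxE.
  by rewrite permM ht hs !map_mxM !mulmxA.
Qed.

Lemma tensor_semilinearX s k i : tensor_semilinear s k -> tensor_semilinear (s ^+ i)%g (k * i).
Proof.
move=> hs; elim: i => [|i IH]; first by rewrite muln0 expg0; apply: tensor_semilinear1.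
by rewrite expgS mulnS; apply: tensor_semilinearM.
Qed.

Lemma GammaL_tensor_semilinear s : s \in GammaL_UW F a b p -> exists k, tensor_semilinear s k.
Proof.
case/gen_prodgP=> n [c hc ->].
elim/big_ind: _ => [|x y [k hk] [l hl]|i _].
- by exists 0%N; apply: tensor_semilinear1.
- by exists (k + l)%N; apply: tensor_semilinearM.
have := hc i; rewrite inE => /orP[]; rewrite inE.
  move=> /existsP[P /existsP[Q /and3P[uP uQ /forallP h]]]; exists 0%N, idfun, P, Q; split=> // X.
  by rewrite map_mx_id //; apply/eqP.
move=> /forallP h; exists 1%N, (pFrobenius_aut pF), 1%:M, 1%:M; split; rewrite ?unitmx1 // => X.
rewrite mul1mx mulmx1 (eqP (h X)); apply/matrixP=> x y; by rewrite !mxE.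
Qed.

Lemma GL_V_group_set : group_set (GL_V F a b).
Proof.
apply/group_setP; split=> [|s t].
  by rewrite inE; do 3! (apply/forallP=> ?); rewrite !perm1.
rewrite !inE => /forallP hs /forallP ht; apply/forallP=> c; apply/forallP=> X; apply/forallP=> Y.
have /forallP/(_ X)/forallP/(_ Y)/eqP es := hs c; rewrite !permM es.
by have /forallP/(_ (s X))/forallP/(_ (s Y)) := ht c.
Qed.

End NormalForm.

Lemma GL_of_unitmx (F : finFieldType) (A : 'M[F]_2) : A \in unitmx ->
  exists u : {'GL_2[F]}, GLval u = A.
Proof. by move=> uA; exists (FinRing.Unit (uA : A \is a GRing.unit)). Qed.

Section TensorReduction.
Variables (p f a b : nat) (F : finFieldType) (H : {group {perm 'M[F]_(a,b)}}).
Variable tau : {rmorphism F -> F}.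
Hypotheses (hp : prime p) (f0 : (0 < f)%N) (cF : #|F| = ((p ^ f) ^ p)%N).
Hypothesis tauE : forall x, tau x = x ^+ (p ^ f).
Hypotheses (a2 : (2 <= a)%N) (b2 : (2 <= b)%N).
Hypotheses (sH : H \subset GammaL_UW F a b p) (exH : p_exceptional p H)
  (coH : coprime #|H :&: GL_V F a b| p).

Let cF' : #|F| = (p ^ (f * p))%N. Proof. by rewrite expnM. Qed.
Let pF : p \in [pchar F] := card_finPcharP cF' hp.
Let GLV := Group (GL_V_group_set F a b).

Let nzmx : exists X : 'M[F]_(a, b), X != 0.
Proof.
exists (delta_mx (Ordinal (ltnW a2)) (Ordinal (ltnW b2))); apply/eqP=> /matrixP.
move/(_ (Ordinal (ltnW a2)) (Ordinal (ltnW b2))); rewrite !mxE !eqxx /= => /eqP.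
by rewrite oner_eq0.
Qed.

(** Let [k] be the Frobenius exponent of [h]. From [h ^ p = 1] it follows that [k = j f]. If [p]
    divided [j], then [h] would be a linear element of order [p], against [coH]; so [j] is
    invertible modulo [p]. *)
Lemma order_p_semilinear h : h \in H -> #[h]%g = p ->
  exists i, exists P Q, [/\ P \in unitmx, Q \in unitmx &
    forall X, (h ^+ i)%g X = P *m map_mx tau X *m Q].
Proof.
move=> hH oh; have [k hk] := GammaL_tensor_semilinear pF (subsetP sH _ hH).
have n0 : (0 < f * p)%N by rewrite muln_gt0 f0 prime_gt0.
have scal s l (phi : {rmorphism F -> F}) (P : 'M[F]_a) (Q : 'M[F]_b) c (X : 'M[F]_(a, b)) :
    (forall x, phi x = x ^+ (p ^ l)) -> (forall X, s X = P *m map_mx phi X *m Q) ->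
    s (c *: X) = c ^+ (p ^ l) *: s X.
  by move=> hphi hs; rewrite !hs map_mxZ hphi -scalemxAr -scalemxAl.
have dk : (f * p %| k * p)%N.
  apply: (frob_period (prime_gt1 hp) cF') => c.
  have := tensor_semilinearX p hk; rewrite -[p in (h ^+ p)%g]oh expg_order.
  move=> [phi [P [Q [hphi _ _ hs]]]]; have [X X0] := nzmx.
  have := scal _ _ _ _ _ c X hphi hs; rewrite !perm1 => /eqP.
  by rewrite -subr_eq0 -scalerBl scaler_eq0 (negPf X0) orbF subr_eq0 => /eqP <-.
move: dk; rewrite dvdn_pmul2r ?prime_gt0 // => /dvdnP[j ej].
have pj : coprime p j.
  rewrite prime_coprime //; apply/negP=> /dvdnP[j' ej'].
  have hGL : h \in H :&: GLV.
    rewrite inE hH inE; apply/forallP=> c; apply/forallP=> X; apply/forallP=> Y; apply/eqP.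
    move: hk => [phi [P [Q [hphi _ _ hs]]]].
    have id c' : phi c' = c'.
      rewrite hphi ej ej' -mulnA [(p * f)%N]mulnC.
      by elim: (j') => [|i IH]; rewrite ?expr1 // mulSn expnD exprM -cF' expf_card.
    by rewrite !hs map_mxD map_mxZ id mulmxDr mulmxDl -scalemxAr -scalemxAl.
  have : (p %| #|H :&: GLV|)%N by rewrite -oh order_dvdG.
  by apply/negP; rewrite -prime_coprime // coprime_sym.
have p0 := prime_gt0 hp.
have j0 : (0 < j)%N by case: j pj {ej} => //; rewrite /coprime gcdn0; case: (p) (prime_gt1 hp) => [|[]].
(* By Bezout [j * u.1] is 1 modulo [p], so the exponent [j f u.1] of [h ^+ u.1] is [f] modulo
   [f p]. *)
have [u eu] : exists u, (u.1 * j - u.2 * p = 1)%N.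
  by apply/(coprimeP _ j0); rewrite coprime_sym.
have {}eu : (j * u.1 = 1 + p * u.2)%N by lia.
exists u.1; have [phi [P [Q [hphi uP uQ hs]]]] := tensor_semilinearX u.1 hk.
exists P, Q; split=> // X; rewrite hs; congr (_ *m _ *m _); apply/matrixP=> x y; rewrite !mxE.
rewrite hphi tauE ej -mulnA [(f * _)%N]mulnC mulnA eu mulnDl mul1n expnD exprM.
rewrite -[RHS]/(X x y ^+ (p ^ f)); move: (X x y ^+ _) => c.
rewrite [(p * u.2)%N]mulnC -mulnA [(p * f)%N]mulnC.
by elim: (u.2) => [|i IH]; rewrite ?expr1 // mulSn expnD exprM -cF' expf_card.
Qed.

(** The orbit of [X] has size prime to [p], so [p] divides the order of its stabilizer and Cauchy's
    theorem applies there. *)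
Lemma fixing_semilinear X : exists h, [/\ h \in H, (h ^+ p = 1)%g, h X = X &
  exists P Q, [/\ P \in unitmx, Q \in unitmx & forall Y, h Y = P *m map_mx tau Y *m Q]].
Proof.
move: exH => /andP[pH /forallP/(_ X) coX].
have : (p %| #|'C_H[X | 'P]%g|)%N.
  move: pH; rewrite -(card_orbit_stab 'P H X) Euclid_dvdM // => /orP[|//].
  by move: coX; rewrite coprime_sym prime_coprime // => /negPf ->.
move/(Cauchy hp)=> [h /setIP[hH /astab1P hX] oh].
have [i hi] := order_p_semilinear hH oh; exists (h ^+ i)%g; split=> //.
- by rewrite groupX.
- by rewrite -expgM mulnC expgM -oh expg_order expg1n.
- have {}hX : h X = X := hX.
  by elim: i {hi} => [|i IH]; rewrite ?perm1 // expgS permM hX.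
Qed.

Let E : 'M[F]_(a, 2) := pid_mx 2.
Let E' : 'M[F]_(2, b) := pid_mx 2.
Let T : 'M[F]_(2, a) := pid_mx 2.
Let T' : 'M[F]_(b, 2) := pid_mx 2.

Let TE : T *m E = 1%:M.
Proof. by rewrite mul_pid_mx minnn (minn_idPr a2) pid_mx_1. Qed.
Let ET' : E' *m T' = 1%:M.
Proof. by rewrite mul_pid_mx minnn (minn_idPr b2) pid_mx_1. Qed.
Let EI Y Y' : E *m Y *m E' = E *m Y' *m E' -> Y = Y'.
Proof.
move/(congr1 (fun X => T *m X *m T')).
by rewrite !mulmxA TE !mul1mx -!mulmxA ET' !mulmx1.
Qed.

Lemma block_form (M : 'M[F]_2) P Q : M \in unitmx -> P \in unitmx -> Q \in unitmx ->
  P *m map_mx tau (E *m M *m E') *m Q = E *m M *m E' ->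
  exists P1 Q1, [/\ P1 \in unitmx, Q1 \in unitmx, P *m E = E *m P1 & E' *m Q = Q1 *m E'].
Proof.
move=> uM uP uQ; rewrite !map_mxM !map_pid_mx -/E -/E' => h.
have uN : map_mx tau M \in unitmx by rewrite map_unitmx.
set N := map_mx tau M in h uN.
(* Both witnesses solve [P E N E' Q = E M E']: move [Q] to the right and multiply by [T' N^-1], or
   move [P] to the right and multiply by [N^-1 T]. *)
pose P1 := M *m E' *m invmx Q *m T' *m invmx N.
pose Q1 := invmx N *m T *m invmx P *m E *m M.
have eP : P *m E = E *m P1.
  rewrite /P1 !mulmxA -h -!mulmxA (mulmxA Q) mulmxV // mul1mx (mulmxA E') ET' mul1mx mulmxV //.
  by rewrite mulmx1.
have eQ : E' *m Q = Q1 *m E'.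
  rewrite /Q1 -!mulmxA (mulmxA E) -h -!mulmxA (mulmxA (invmx P)) mulVmx // mul1mx.
  by rewrite (mulmxA T) TE mul1mx (mulmxA (invmx N)) mulVmx // mul1mx.
exists P1, Q1; split=> //.
  have : (T *m invmx P *m E) *m P1 = 1%:M.
    by rewrite -!mulmxA -eP (mulmxA (invmx P)) mulVmx // mul1mx TE.
  by case/mulmx1_unit.
have : Q1 *m (E' *m invmx Q *m T') = 1%:M.
  by rewrite !mulmxA -eQ mulmxK.
by case/mulmx1_unit.
Qed.

(* [E], [E'] embed the 2 x 2 matrices as the top left corner of ['M_(a, b)].  [L u w] (resp. [S P R])
   says that an element of [H] which is linear (resp. semilinear for [tau]) acts on that corner as
   [Y |-> u Y w^T] (resp. [Y |-> P tau(Y) R^T]); the transpose makes the two factors play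
   symmetric roles. *)
Let L (u w : {'GL_2[F]}) := [exists h in H :&: GL_V F a b,
  [forall Y, h (E *m Y *m E') == E *m (GLval u *m Y *m (GLval w)^T) *m E']].
Let S (P R : 'M[F]_2) := [exists h in H, [&&
  [forall c, forall X, forall Y, h (c *: X + Y) == tau c *: h X + h Y],
  P \in unitmx, R \in unitmx &
  [forall Y, h (E *m Y *m E') == E *m (P *m map_mx tau Y *m R^T) *m E']]].

Let Lscalar z : z \in GLscalar F -> L z z^-1.
Proof.
move=> zZ; have [c ec] : exists c, GLval z = c%:M.
  by apply/is_scalar_mxP; move: zZ; rewrite inE.
have [d ed] : exists d, GLval z^-1 = d%:M.
  by apply/is_scalar_mxP; move: (groupVr (zZ : z \in GLscalar_group F)); rewrite inE.
have := GL_mulKV z; rewrite ec ed => ez.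
apply/existsP; exists 1%g; apply/andP; split; first exact: (group1 (H :&: GLV)%G).
apply/forallP=> Y; rewrite perm1 ec ed tr_scalar_mx mul_scalar_mx mul_mx_scalar scalerA.
have cd : d * c = 1 by move: ez; rewrite -scalar_mxM mulrC => /matrixP/(_ 0 0); rewrite !mxE.
by rewrite cd scale1r.
Qed.

Let LM u w u' w' : L u w -> L u' w' -> L (u * u')%g (w * w')%g.
Proof.
move=> /existsP[h /andP[hH /forallP eh]] /existsP[h' /andP[hH' /forallP eh']].
apply/existsP; exists (h' * h)%g; apply/andP; split.
  exact: (groupM (hH' : h' \in (H :&: GLV)%G) (hH : h \in (H :&: GLV)%G)).
apply/forallP=> Y; rewrite permM (eqP (eh' _)) (eqP (eh _)) !GL_MxE trmx_mul.
by rewrite !mulmxA.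
Qed.

(** The power of [h] by the group order is 1, so [Y |-> u^n Y (w^n)^T] is the identity. *)
Let Lexp u w : L u w -> is_scalar_mx (GLval u ^+ #|H :&: GL_V F a b|) /\
  is_scalar_mx (GLval w ^+ #|H :&: GL_V F a b|).
Proof.
move=> /existsP[h /andP[hH /forallP eh]]; set n := #|_|.
have hX i Y : (h ^+ i)%g (E *m Y *m E') = E *m (GLval u ^+ i *m Y *m (GLval w ^+ i)^T) *m E'.
  elim: i Y => [|i IH] Y; first by rewrite perm1 !expr0 trmx1 mul1mx mulmx1.
  rewrite expgS permM (eqP (eh Y)) IH !exprSr -[_ * GLval u]/(_ *m _) -[_ * GLval w]/(_ *m _).
  by rewrite trmx_mul !mulmxA.
have h1 : (h ^+ n = 1)%g := expg_cardG (hH : h \in (H :&: GLV)%G).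
have key Y : GLval u ^+ n *m Y *m (GLval w ^+ n)^T = Y.
  by apply: EI; rewrite -hX h1 perm1.
have [c _ [-> ->]] := mx2_two_sided key.
by rewrite !scalar_mx_is_scalar.
Qed.

(** In [h'^-1 * h] the two field automorphisms cancel, which leaves a linear element of [H]. *)
Let LS P R P' R' : S P R -> S P' R' ->
  exists u w, [/\ L u w, GLval u *m P' = P & GLval w *m R' = R].
Proof.
move=> /existsP[h /andP[hH /and4P[/forallP lh uP uR /forallP eh]]].
move=> /existsP[h' /andP[hH' /and4P[/forallP lh' uP' uR' /forallP eh']]].
have [u eu] : exists u : {'GL_2[F]}, GLval u = P *m invmx P'.
  by apply: GL_of_unitmx; rewrite unitmx_mul uP unitmx_inv.
have [w ew] : exists w : {'GL_2[F]}, GLval w = R *m invmx R'.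
  by apply: GL_of_unitmx; rewrite unitmx_mul uR unitmx_inv.
exists u, w; rewrite eu ew !mulmxKV //; split=> //.
(* [tau] is onto because its [p]-th iterate is the identity. *)
have tsurj n l (A : 'M[F]_(n, l)) : exists B, map_mx tau B = A.
  exists (iter p.-1 (map_mx tau) A).
  by rewrite -iterS prednK ?prime_gt0 // (iter_map_tau_id cF tauE).
have tsurj1 (c : F) : exists d, tau d = c.
  have [B /matrixP/(_ 0 0)] := tsurj 1%N 1%N c%:M; rewrite !mxE eqxx mulr1n => e.
  by exists (B 0 0).
apply/existsP; exists (h'^-1 * h)%g; apply/andP; split.
  rewrite inE groupM ?groupV //= inE; apply/forallP=> c; apply/forallP=> X; apply/forallP=> Y.
  rewrite !permM; have [d ed] := tsurj1 c.
  rewrite -{1}[X](permKV h') -{1}[Y](permKV h') -ed.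
  have /forallP/(_ ((h'^-1)%g X))/forallP/(_ ((h'^-1)%g Y))/eqP <- := lh' d.
  by rewrite permK; have /forallP/(_ ((h'^-1)%g X))/forallP/(_ ((h'^-1)%g Y)) := lh d.
apply/forallP=> Y; rewrite permM eu ew.
have [B eB] := tsurj _ _ (invmx P' *m Y *m (invmx R')^T).
have <- : h' (E *m B *m E') = E *m Y *m E'.
  rewrite (eqP (eh' B)) eB !mulmxA -[E *m P' *m _]mulmxA mulmxV // mulmx1.
  by rewrite -!mulmxA (mulmxA (invmx R')^T) -trmx_mul mulmxV // trmx1 mul1mx.
by rewrite permK (eqP (eh B)) eB trmx_mul !mulmxA.
Qed.

Let SZ P R c : S P R -> c != 0 -> S (c *: P) (c^-1 *: R).
Proof.
move=> /existsP[h /andP[hH /and4P[lh uP uR /forallP eh]]] c0.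
apply/existsP; exists h; rewrite hH lh !unitmxZ ?unitfE ?invr_eq0 // uP uR /=.
apply/forallP=> Y; rewrite (eqP (eh Y)) linearZ /= -!scalemxAl -!scalemxAr scalerA mulfV //.
by rewrite scale1r.
Qed.

Lemma invertible_covered (M : 'M[F]_2) : M \in unitmx -> exists P R,
  [/\ P \in [set P | (mxnorm tau P p == 1%:M) && [exists R, S P R]],
      R \in [set R | (mxnorm tau R p == 1%:M) && [exists P, S P R]],
      S P R & P *m map_mx tau M *m R^T = M].
Proof.
move=> uM; have [h [hH h1 hM [P [Q [uP uQ eh]]]]] := fixing_semilinear (E *m M *m E').
have [P1 [Q1 [uP1 uQ1 eP eQ]]] := block_form uM uP uQ (etrans (esym (eh _)) hM).
pose R1 := Q1^T.
have blk Y : h (E *m Y *m E') = E *m (P1 *m map_mx tau Y *m R1^T) *m E'.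
  rewrite eh !map_mxM !map_pid_mx -/E -/E' trmxK !mulmxA eP -!mulmxA eQ.
  by [].
have S1 : S P1 R1.
  apply/existsP; exists h; rewrite hH uP1 unitmx_tr uQ1 /=; apply/andP; split.
    apply/forallP=> c; apply/forallP=> X; apply/forallP=> Y.
    by rewrite !eh map_mxD map_mxZ mulmxDr mulmxDl -scalemxAr -scalemxAl.
  by apply/forallP=> Y; rewrite blk.
have nrm Y : mxnorm tau P1 p *m Y *m (mxnorm tau R1 p)^T = Y.
  have hi i : (h ^+ i)%g (E *m Y *m E') = 
     E *m (mxnorm tau P1 i *m iter i (map_mx tau) Y *m (mxnorm tau R1 i)^T) *m E'.
    elim: i => [|i IH]; first by rewrite perm1 /mxnorm trmx1 mul1mx mulmx1.
    rewrite expgSr permM IH blk /mxnorm !iterS /frob_act !map_mxM trmx_mul map_trmx.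
    by rewrite !mulmxA.
  by apply: EI; rewrite -{1}(iter_map_tau_id cF tauE Y) -hi h1 perm1.
(* Since [h ^ p = 1], the norms of [P1] and [R1] are mutually inverse scalars, so scaling by [l] and
   [l^-1] normalizes both at once and leaves the action on the corner unchanged. *)
have [c c0 [eP1 eR1]] := mx2_two_sided nrm.
have q1 : (1 < p ^ f)%N by rewrite -(exp1n f) ltn_exp2r // prime_gt1.
have [l l0 Nl] := mxnorm_normalize q1 (prime_gt0 hp) cF tauE uP1 eP1.
have Sl := SZ S1 l0.
exists (l *: P1), (l^-1 *: R1); split=> //.
- by rewrite inE Nl eqxx; apply/existsP; exists (l^-1 *: R1).
- rewrite inE; apply/andP; split; last by apply/existsP; exists (l *: P1).
  move: Nl; rewrite !(mxnormZ tauE) eP1 eR1 !scale_scalar_mx exprVn -invfM => /matrixP/(_ 0 0).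
  by rewrite !mxE eqxx !mulr1n => ->; rewrite invr1.
apply: EI; rewrite linearZ /= -!scalemxAl -!scalemxAr scalerA mulfV // scale1r.
by rewrite -blk.
Qed.

Lemma p_exceptional_tensor_absurd : False.
Proof.
have lower := card_cover hp f0 cF tauE SZ invertible_covered.
have c1 := @card_semilinear_parts F p f tau _ L S hp f0 cF tauE coH.
(* The second tensor factor: the same bound with the arguments of [L] and [S] exchanged. *)
have c2 := @card_semilinear_parts F p f tau _ (fun w u => L u w) (fun R P => S P R) hp f0 cF tauE coH.
have {}c1 : (#|[set P | (mxnorm tau P p == 1%:M) && [exists R, S P R]]| <=
    (\sum_(i < p) (p ^ f) ^ i) * (\sum_(i < p) (p ^ f) ^ i))%N.
  apply: c1 => [z /Lscalar|u w u' w'|u w /Lexp[]|P R P' R' h h'] //; [by exists z^-1%g|exact: LM|].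
  by have [u [w [Lu e _]]] := LS h h'; exists u, w.
have {}c2 : (#|[set R | (mxnorm tau R p == 1%:M) && [exists P, S P R]]| <=
    (\sum_(i < p) (p ^ f) ^ i) * (\sum_(i < p) (p ^ f) ^ i))%N.
  apply: c2 => [z|u w u' w'|u w /Lexp[]|P R P' R' h h'] //; [|exact: LM|].
    move=> zZ; exists z^-1%g; have := Lscalar (groupVr (zZ : z \in GLscalar_group F)).
    by rewrite invgK.
  by have [u [w [Lu _ e]]] := LS h h'; exists w, u.
have q1 : (1 < p ^ f)%N by rewrite -(exp1n f) ltn_exp2r // prime_gt1.
(* In [cover_arith] the cofactor [s] is [q ^ (p - 1)], which is at least [q] because [p >= 2]. *)
have eQ : #|F| = (p ^ f * (p ^ f) ^ p.-1)%N by rewrite cF -expnS prednK // prime_gt0.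
have qs : (p ^ f <= (p ^ f) ^ p.-1)%N.
  by rewrite -{1}(expn1 (p ^ f)) leq_exp2l // -ltnS prednK ?prime_gt0 // prime_gt1.
apply: (cover_arith q1 qs eQ (normexpE cF)); apply: leq_trans lower _.
by rewrite leq_mul2r (leq_mul c1 c2) orbT.
Qed.
End TensorReduction.

Close Scope ring_scope.

Theorem theorem4p2 (p e a b : nat) (F : finFieldType)
    (H : {group {perm 'M[F]_(a,b)}}) :
  prime p -> (0 < e)%N -> #|F| = ((p ^ e) ^ p)%N ->
  (2 <= a)%N -> (a <= b)%N ->
  H \subset GammaL_UW F a b p ->
  p_exceptional p H ->
  coprime #|H :&: GL_V F a b| p ->
  [/\ p = 2%N, a = 2%N & ~~ abs_irr (H :&: GL_V F a b)].
Proof.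
move=> hp e0 cF a2 ab sH exH coH; exfalso.
have pF : p \in [pchar F]%R by apply: (@card_finPcharP _ _ (e * p)); rewrite // expnM.
have [tau tauE] := frob_iter_rmorphism e pF.
exact: (p_exceptional_tensor_absurd hp e0 cF tauE a2 (leq_trans a2 ab) sH exH coH).
Qed.
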